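(* Let $Q$ be an acyclic quiver, and let $\mathcal{Q}^\bullet=\{Q^1,\dots,Q^\ell\}$ be an admissible Dynkin subquiver partition of $Q$. Suppose that the roots $\{\phi_1\prec\cdots\prec\phi_r\}=\Phi(Q,\mathcal{Q}^\bullet)$ are totally ordered so that for all $u<v$: if $\phi_u,\phi_v$ belong to the same $\Phi^j$ then $\lambda(\phi_u,\phi_v)\ge 0$, and if $\phi_u\in\Phi^j$, $\phi_v\in\Phi^{j'}$ with $j\neq j'$ then $\lambda(\phi_u,\phi_v)\le 0$. Then in the completed quantum algebra $\widehat{\mathbb{A}}_Q$, $$\mathbb{E}_Q=\mathbb{E}(y_{\phi_1})\,\mathbb{E}(y_{\phi_2})\cdots\mathbb{E}(y_{\phi_r}).$$
   Context: A quiver $Q=(Q_0,Q_1)$ is a finite set of vertices and a finite set of arrows (multiple arrows allowed), each $a\in Q_1$ having tail $ta$ and head $ha$ in $Q_0$. It is acyclic if it has no oriented cycles (in particular no loops). The vertices are labeled $Q_0=\{1,\dots,n\}$ so that the head of any arrow comes before its tail. $D_Q=\mathbb{N}^{Q_0}$ is the monoid of dimension vectors with basis $e_i$. $\lambda:D_Q\times D_Q\to\mathbb{Z}$ is the biadditive form with $\lambda(e_i,e_j)=|\{a\in Q_1: ta=i, ha=j\}|-|\{a\in Q_1: ta=j, ha=i\}|$. Quantum algebra: let $q^{1/2}$ be a variable with square $q$. $\mathbb{A}_Q$ is the $\mathbb{Q}(q^{1/2})$-algebra generated by symbols $y_\gamma$, $\gamma\in D_Q$, with relations $y_{\gamma_1+\gamma_2}=-q^{-\frac12\lambda(\gamma_1,\gamma_2)}y_{\gamma_1}y_{\gamma_2}$.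 The $y_\gamma$ form a vector space basis (so the unit is $1=-y_0$), and the $y_{e_i}$ generate $\mathbb{A}_Q$ as an algebra. $\widehat{\mathbb{A}}_Q$ is its completion with respect to the ideal generated by the $y_{e_i}$, $i\in Q_0$ (formal power series in the $y_\gamma$ are allowed). Quantum dilogarithm series: $\displaystyle \mathbb{E}(z)=1+\sum_{k\ge1}\frac{(-z)^kq^{k^2/2}}{\prod_{j=1}^k(1-q^j)}\in\mathbb{Q}(q^{1/2})[[z]]$. $\mathbb{E}_Q\in\widehat{\mathbb{A}}_Q$ denotes the combinatorial (refined) Donaldson–Thomas invariant of $Q$, given by the ordered product $\mathbb{E}_Q=\mathbb{E}(y_{e_1})\mathbb{E}(y_{e_2})\cdots\mathbb{E}(y_{e_n})$. A Dynkin quiver is an orientation of a simply-laced Dynkin diagram (type $A$, $D$, $E$); a positive root $\sum_i d^i\alpha_i$ is identified with the dimension vector $\sum_i d^ie_i$. A Dynkin subquiver partition $\mathcal{Q}^\bullet=\{Q^1,\dots,Q^\ell\}$ of $Q$ is a collection of disjoint, nonempty, connected Dynkin subquivers (not necessarily full) with $Q_0=\bigcup_jQ^j_0$; arrows of $Q$ need not lie in any $Q^j_1$. $\Phi^j\subseteq D_Q$ is the set of positive roots of $Q^j$ (extended by zero outside $Q^j_0$), and $\Phi(Q,\mathcal{Q}^\bullet)=\bigcup_j\Phi^j$, $r=|\Phi(Q,\mathcal{Q}^\bullet)|$. The quiver $P(Q,\mathcal{Q}^\bullet)$ is obtained by contracting each $Q^j$ to a single vertex, with arrow set $Q_1\setminus\bigcup_jQ^j_1$;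 $\mathcal{Q}^\bullet$ is admissible if $P(Q,\mathcal{Q}^\bullet)$ is acyclic (no loops, no oriented cycles). *)

(* Defs.v *)
From HB Require Import structures.
From mathcomp Require Import all_boot all_order all_algebra.
From mathcomp Require Import fraction ring boolp.

Set Implicit Arguments.
Unset Strict Implicit.
Unset Printing Implicit Defensive.

Import Order.TTheory GRing.Theory Num.Theory.
Local Open Scope ring_scope.

Record quiver := Quiver {
  vert : finType;
  arrow : finType;
  tl : arrow -> vert;
  hd : arrow -> vert
}.

(* An oriented cycle is a nonempty cyclic sequence of arrows, each ending where
   the next one starts; a loop is one of length 1. *)
Definition acyclic (Q : quiver) : Prop :=
  forall s : seq (arrow Q), cycle (fun a b => hd a == tl b) s -> s = [::].

(* A labeling of the vertices by 1, ..., n is given as the list of the vertices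
   in the order of their labels. *)
Definition labeling (Q : quiver) (s : seq (vert Q)) : Prop :=
  [/\ uniq s, s =i predT &
      forall a : arrow Q, (index (hd a) s < index (tl a) s)%N].

Definition narrows (Q : quiver) (i j : vert Q) : nat :=
  #|[set a : arrow Q | (tl a == i) && (hd a == j)]|.

(* The number of edges between [i] and [j] (of loops at [i] when [i = j]) in the
   underlying graph. *)
Definition nedges (Q : quiver) (i j : vert Q) : nat :=
  #|[set a : arrow Q | ((tl a == i) && (hd a == j))
                     || ((tl a == j) && (hd a == i))]|.

Definition dimvec (Q : quiver) := {ffun vert Q -> nat}.
HB.instance Definition _ (Q : quiver) := GRing.Nmodule.on (dimvec Q).

Definition basis_dimvec (Q : quiver) (i : vert Q) : dimvec Q :=
  [ffun j => (i == j : nat)].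

Definition total_dim (Q : quiver) (d : dimvec Q) : nat := (\sum_i d i)%N.

Definition lambda (Q : quiver) (d e : dimvec Q) : int :=
  \sum_i \sum_j (d i)%:Z * (e j)%:Z * ((narrows i j)%:Z - (narrows j i)%:Z).

Inductive dynkin_type := TypeA of nat | TypeD of nat | TypeE of nat.

Definition dynkin_valid (T : dynkin_type) : bool :=
  match T with
  | TypeA n => (1 <= n)%N
  | TypeD n => (4 <= n)%N
  | TypeE n => (6 <= n <= 8)%N
  end.

Definition dynkin_rank (T : dynkin_type) : nat :=
  match T with TypeA n | TypeD n | TypeE n => n end.

(* The nodes are 0, ..., n - 1.  In type A they form a path; in types D and E
   the nodes 0, ..., n - 2 form a path, and the node n - 1 is attached to the
   node n - 3 (type D) or 2 (type E) of this path. *)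
Definition dynkin_link (T : dynkin_type) (i j : nat) : bool :=
  match T with
  | TypeA _ => i.+1 == j
  | TypeD n => if j == n.-1 then i == (n - 3)%N else i.+1 == j
  | TypeE n => if j == n.-1 then i == 2%N else i.+1 == j
  end.

Definition dynkin_adj (T : dynkin_type) (i j : nat) : bool :=
  dynkin_link T i j || dynkin_link T j i.

Definition dynkin (Q : quiver) : Prop :=
  exists2 T : dynkin_type, dynkin_valid T &
  exists2 f : vert Q -> 'I_(dynkin_rank T), bijective f &
  forall i j : vert Q, nedges i j = dynkin_adj T (f i) (f j).

(* Elements of the root lattice are written in the basis of the simple roots. *)
Definition root_lattice (Q : quiver) := {ffun vert Q -> int}.

Definition simple_root (Q : quiver) (i : vert Q) : root_lattice Q :=
  [ffun j => (i == j)%:Z].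

Definition cartan (Q : quiver) (i j : vert Q) : int :=
  if i == j then 2 else - (nedges i j)%:Z.

Definition simple_reflection (Q : quiver) (j : vert Q) (b : root_lattice Q) :
    root_lattice Q :=
  [ffun k => b k - (\sum_i b i * cartan i j) * simple_root j k].

(* The root system is the orbit of the simple roots under the Weyl group. *)
Inductive is_root (Q : quiver) : root_lattice Q -> Prop :=
| is_root_simple (i : vert Q) : is_root (simple_root i)
| is_root_reflection (j : vert Q) (b : root_lattice Q) :
    is_root b -> is_root (simple_reflection j b).

Definition positive_root (Q : quiver) (d : dimvec Q) : Prop :=
  is_root ([ffun i => (d i)%:Z] : root_lattice Q).

Record subquiver (Q : quiver) := Subquiver {
  sub_vert : {set vert Q};
  sub_arrow : {set arrow Q};
  sub_tl : forall a, a \in sub_arrow -> tl a \in sub_vert;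
  sub_hd : forall a, a \in sub_arrow -> hd a \in sub_vert
}.

Definition quiver_of_sub (Q : quiver) (S : subquiver Q) : quiver :=
  @Quiver {i : vert Q | i \in sub_vert S} {a : arrow Q | a \in sub_arrow S}
    (fun a => Sub (tl (val a)) (sub_tl (valP a)))
    (fun a => Sub (hd (val a)) (sub_hd (valP a))).

Definition extend_dimvec (Q : quiver) (S : subquiver Q)
    (d : dimvec (quiver_of_sub S)) : dimvec Q :=
  [ffun i => if insub i is Some k then d k else 0%N].

(* Members are nonempty and connected because every Dynkin diagram is. *)
Record dynkin_partition (Q : quiver) := DynkinPartition {
  nparts : nat;
  part : 'I_nparts -> subquiver Q;
  part_dynkin : forall j, dynkin (quiver_of_sub (part j));
  part_disjoint : forall j k, j != k ->
    [disjoint sub_vert (part j) & sub_vert (part k)];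
  part_cover : forall i : vert Q, exists j, i \in sub_vert (part j)
}.

Arguments part {Q} P j : rename.

Definition part_of (Q : quiver) (P : dynkin_partition Q) (i : vert Q) :
    'I_(nparts P) :=
  xchoose (part_cover P i).

Definition contraction (Q : quiver) (P : dynkin_partition Q) : quiver :=
  @Quiver 'I_(nparts P)
    {a : arrow Q | a \notin \bigcup_j sub_arrow (part P j)}
    (fun a => part_of P (tl (val a))) (fun a => part_of P (hd (val a))).

Definition admissible (Q : quiver) (P : dynkin_partition Q) : Prop :=
  acyclic (contraction P).

Definition part_root (Q : quiver) (P : dynkin_partition Q) (j : 'I_(nparts P))
    (d : dimvec Q) : Prop :=
  exists2 b : dimvec (quiver_of_sub (part P j)),
    positive_root b & d = extend_dimvec b.

Definition partition_root (Q : quiver) (P : dynkin_partition Q)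
    (d : dimvec Q) : Prop :=
  exists j : 'I_(nparts P), part_root j d.

Definition base_field := {fraction {poly rat}}.
HB.instance Definition _ := GRing.Field.on base_field.

Definition qhalf : base_field := tofrac ('X : {poly rat}).
Definition qvar : base_field := qhalf ^+ 2.

(* Since the [y_d] form a basis of the quantum algebra, and the m-th power of
   the ideal generated by the [y_(e_i)] is spanned by the [y_d] with
   [m <= total_dim d], an element of the completion is a formal series
   [\sum_d (coef f d) *: y d], that is, an arbitrary family of coefficients. *)
Record qseries (Q : quiver) := QSeries { coef : dimvec Q -> base_field }.

Section QuantumAlgebra.
Variable Q : quiver.
Implicit Types (d e a b c : dimvec Q) (f g h : qseries Q) (x : base_field).

Definition box (n : nat) : seq (dimvec Q) :=
  [seq [ffun i => val (u i)] | u : {ffun vert Q -> 'I_n.+1}].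

Definition decomp d : seq (dimvec Q * dimvec Q) :=
  [seq p <- [seq (a, b) | a <- box (total_dim d), b <- box (total_dim d)]
     | p.1 + p.2 == d].

Definition y d : qseries Q := QSeries (fun e => (d == e)%:R).

(* Bilinear extension of [y a * y b = - q^(lambda(a, b) / 2) y (a + b)]. *)
Definition qmul f g : qseries Q :=
  QSeries (fun d => \sum_(p <- decomp d)
    - qhalf ^ (lambda p.1 p.2) * coef f p.1 * coef g p.2).

Definition qone : qseries Q := QSeries (fun d => - coef (y 0) d).
Definition qzero : qseries Q := QSeries (fun=> 0).
Definition qadd f g : qseries Q := QSeries (fun d => coef f d + coef g d).
Definition qopp f : qseries Q := QSeries (fun d => - coef f d).
Definition qscale x f : qseries Q := QSeries (fun d => x * coef f d).

Lemma qseriesP f g : coef f =1 coef g -> f = g.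
Proof. by case: f g => [f] [g] /= /funext ->. Qed.

Lemma mem_box n d : (d \in box n) = [forall i, (d i <= n)%N].
Proof.
apply/mapP/forallP => [[u _ ->] i|dn]; first by rewrite ffunE -ltnS ltn_ord.
exists [ffun i => inord (d i)]; first by rewrite mem_enum.
by apply/ffunP => i; rewrite !ffunE /= inordK // ltnS.
Qed.

Lemma box_uniq n : uniq (box n).
Proof.
rewrite map_inj_uniq ?enum_uniq // => u v /ffunP uv.
by apply/ffunP => i; apply: val_inj; have := uv i; rewrite !ffunE.
Qed.

Lemma leq_total_dim d i : (d i <= total_dim d)%N.
Proof. by rewrite /total_dim (bigD1 i) //= leq_addr. Qed.

Lemma dimvec_addE d e i : (d + e) i = (d i + e i)%N.
Proof. by rewrite ffunE. Qed.

Lemma total_dimD d e : total_dim (d + e) = (total_dim d + total_dim e)%N.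
Proof.
by rewrite /total_dim -big_split; apply: eq_bigr => i _; rewrite dimvec_addE.
Qed.

Lemma mem_decomp d p : (p \in decomp d) = (p.1 + p.2 == d).
Proof.
rewrite mem_filter; case: eqP => //= <-; case: p => a b /=.
rewrite allpairs_f // mem_box; apply/forallP => i;
  apply: leq_trans (leq_total_dim _ _) _;
  by rewrite total_dimD (leq_addr, leq_addl).
Qed.

Lemma decomp_uniq d : uniq (decomp d).
Proof.
apply/filter_uniq/allpairs_uniq; try exact: box_uniq.
by case=> ? ? [? ?].
Qed.

Lemma lambdaDl a b c : lambda (a + b) c = lambda a c + lambda b c.
Proof.
rewrite /lambda -big_split; apply: eq_bigr => i _.
rewrite -big_split; apply: eq_bigr => j _ /=.
by rewrite dimvec_addE PoszD !mulrDl.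
Qed.

Lemma lambdaDr a b c : lambda a (b + c) = lambda a b + lambda a c.
Proof.
rewrite /lambda -big_split; apply: eq_bigr => i _.
rewrite -big_split; apply: eq_bigr => j _ /=.
by rewrite dimvec_addE PoszD -mulrDl -mulrDr.
Qed.

Lemma lambda0l a : lambda 0 a = 0.
Proof. by apply: (addrI (lambda 0 a)); rewrite -lambdaDl !addr0. Qed.

Lemma lambda0r a : lambda a 0 = 0.
Proof. by apply: (addrI (lambda a 0)); rewrite -lambdaDr !addr0. Qed.

Lemma dimvec_addI : right_injective (+%R : dimvec Q -> _ -> _).
Proof.
move=> d a b /ffunP ab; apply/ffunP => i; have := ab i.
by rewrite !dimvec_addE => /addnI.
Qed.

Lemma qhalf_neq0 : qhalf != 0.
Proof. by rewrite tofrac_eq0 polyX_eq0. Qed.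

Fact qaddA : associative qadd.
Proof. by move=> f g h; apply: qseriesP => d /=; rewrite addrA. Qed.

Fact qaddC : commutative qadd.
Proof. by move=> f g; apply: qseriesP => d /=; rewrite addrC. Qed.

Fact qadd0 : left_id qzero qadd.
Proof. by move=> f; apply: qseriesP => d /=; rewrite add0r. Qed.

Fact qaddN : left_inverse qzero qopp qadd.
Proof. by move=> f; apply: qseriesP => d /=; rewrite addNr. Qed.

Fact qmulA : associative qmul.
Proof.
move=> f g h; apply: qseriesP => d /=.
pose F (t : dimvec Q * dimvec Q * dimvec Q) : base_field :=
  qhalf ^ (lambda t.1.1 t.1.2 + lambda t.1.1 t.2 + lambda t.1.2 t.2)
  * coef f t.1.1 * coef g t.1.2 * coef h t.2.
pose s1 := [seq (p.1, r.1, r.2) | p <- decomp d, r <- decomp p.2].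
pose s2 := [seq (r.1, r.2, p.2) | p <- decomp d, r <- decomp p.1].
transitivity (\sum_(t <- s1) F t).
  rewrite big_allpairs_dep /=; apply: eq_bigr => p _; rewrite mulr_sumr.
  apply: eq_big_seq => r; rewrite mem_decomp => /eqP rE.
  rewrite /F /= -rE lambdaDr !expfzDr ?qhalf_neq0 //.
  by ring.
transitivity (\sum_(t <- s2) F t); last first.
  rewrite big_allpairs_dep /=; apply: eq_bigr => p _.
  rewrite mulr_sumr mulr_suml.
  apply: eq_big_seq => r; rewrite mem_decomp => /eqP rE.
  rewrite /F /= -rE lambdaDl !expfzDr ?qhalf_neq0 //.
  by ring.
apply: perm_big; apply: uniq_perm.
- apply: allpairs_uniq_dep => [|p _|]; try exact: decomp_uniq.
  move=> u v /allpairsPdep[[p1 p2] [[r1 r2] [_ + ->]]].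
  move=> + /allpairsPdep[[p1' p2'] [[r1' r2'] [_ + ->]]] /=.
  by rewrite !mem_decomp /= => /eqP <- /eqP <- [-> -> ->].
- apply: allpairs_uniq_dep => [|p _|]; try exact: decomp_uniq.
  move=> u v /allpairsPdep[[p1 p2] [[r1 r2] [_ + ->]]].
  move=> + /allpairsPdep[[p1' p2'] [[r1' r2'] [_ + ->]]] /=.
  by rewrite !mem_decomp /= => /eqP <- /eqP <- [-> -> ->].
- move=> [[a b] c]; apply/allpairsPdep/allpairsPdep.
  + move=> [[p1 p2] [[r1 r2] []]]; rewrite !mem_decomp /=.
    move=> /eqP <- /eqP <- [-> -> ->].
    by exists (p1 + r1, r2), (p1, r1); rewrite !mem_decomp /= addrA !eqxx.
  + move=> [[p1 p2] [[r1 r2] []]]; rewrite !mem_decomp /=.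
    move=> /eqP <- /eqP <- [-> -> ->].
    by exists (r1, r2 + p2), (r2, p2); rewrite !mem_decomp /= addrA !eqxx.
Qed.

Lemma coef_qmul_y a f d :
  coef (qmul (y a) f) (a + d) = - qhalf ^ lambda a d * coef f d.
Proof.
rewrite /= (bigD1_seq (a, d)) ?mem_decomp ?decomp_uniq //= eqxx mulr1.
rewrite big_seq_cond big1 ?addr0 // => -[b c]; rewrite mem_decomp /=.
case/andP=> /eqP bcE; case: (eqVneq a b) bcE => [<-|]; last by rewrite mulr0 mul0r.
by move=> /dimvec_addI ->; rewrite eqxx.
Qed.

Lemma coef_qmulr_y a f d :
  coef (qmul f (y a)) (d + a) = - qhalf ^ lambda d a * coef f d.
Proof.
rewrite /= (bigD1_seq (d, a)) ?mem_decomp ?decomp_uniq //= eqxx mulr1.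
rewrite big_seq_cond big1 ?addr0 // => -[b c]; rewrite mem_decomp /=.
case/andP=> /eqP bcE; case: (eqVneq a c) bcE => [<-|]; last by rewrite mulr0.
by rewrite ![_ + a]addrC => /dimvec_addI ->; rewrite eqxx.
Qed.

Fact qmul1l : left_id qone qmul.
Proof.
move=> f; apply: qseriesP => d.
transitivity (- coef (qmul (y 0) f) (0 + d)).
  by rewrite add0r /= -sumrN; apply: eq_bigr => p _; rewrite mulrN mulNr.
by rewrite coef_qmul_y lambda0l expr0z mulN1r opprK.
Qed.

Fact qmul1r : right_id qone qmul.
Proof.
move=> f; apply: qseriesP => d.
transitivity (- coef (qmul f (y 0)) (d + 0)).
  by rewrite addr0 /= -sumrN; apply: eq_bigr => p _; rewrite mulrN.
by rewrite coef_qmulr_y lambda0r expr0z mulN1r opprK.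
Qed.

Fact qmulDl : left_distributive qmul qadd.
Proof.
move=> f g h; apply: qseriesP => d; rewrite /= -big_split.
by apply: eq_bigr => p _ /=; rewrite mulrDr mulrDl.
Qed.

Fact qmulDr : right_distributive qmul qadd.
Proof.
move=> f g h; apply: qseriesP => d; rewrite /= -big_split.
by apply: eq_bigr => p _ /=; rewrite mulrDr.
Qed.

Fact qone_neq0 : qone <> qzero.
Proof.
move/(congr1 (fun f => coef f 0)) => /= /eqP.
by rewrite eqxx oppr_eq0 oner_eq0.
Qed.

Fact qscaleA x1 x2 f : qscale x1 (qscale x2 f) = qscale (x1 * x2) f.
Proof. by apply: qseriesP => d /=; rewrite mulrA. Qed.

Fact qscale1 : left_id 1 qscale.
Proof. by move=> f; apply: qseriesP => d /=; rewrite mul1r. Qed.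

Fact qscaleDr : right_distributive qscale qadd.
Proof. by move=> x f g; apply: qseriesP => d /=; rewrite mulrDr. Qed.

Fact qscaleDl f x1 x2 : qscale (x1 + x2) f = qadd (qscale x1 f) (qscale x2 f).
Proof. by apply: qseriesP => d /=; rewrite mulrDl. Qed.

Fact qscaleAl x f g : qscale x (qmul f g) = qmul (qscale x f) g.
Proof.
apply: qseriesP => d; rewrite /= mulr_sumr.
by apply: eq_bigr => p _; ring.
Qed.

Fact qscaleAr x f g : qscale x (qmul f g) = qmul f (qscale x g).
Proof.
apply: qseriesP => d; rewrite /= mulr_sumr.
by apply: eq_bigr => p _; ring.
Qed.

End QuantumAlgebra.

Section QuantumAlgebraInstances.
Variable Q : quiver.

HB.instance Definition _ := gen_eqMixin (qseries Q).
HB.instance Definition _ := gen_choiceMixin (qseries Q).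

HB.instance Definition _ := GRing.isZmodule.Build (qseries Q)
  (@qaddA Q) (@qaddC Q) (@qadd0 Q) (@qaddN Q).

HB.instance Definition _ := GRing.Zmodule_isNzRing.Build (qseries Q)
  (@qmulA Q) (@qmul1l Q) (@qmul1r Q) (@qmulDl Q) (@qmulDr Q)
  (introN eqP (@qone_neq0 Q)).

HB.instance Definition _ := GRing.Zmodule_isLmodule.Build base_field (qseries Q)
  (@qscaleA Q) (@qscale1 Q) (@qscaleDr Q) (@qscaleDl Q).

HB.instance Definition _ :=
  GRing.Lmodule_isLalgebra.Build base_field (qseries Q) (@qscaleAl Q).

HB.instance Definition _ :=
  GRing.Lalgebra_isAlgebra.Build base_field (qseries Q) (@qscaleAr Q).

End QuantumAlgebraInstances.

Section QuantumDilogarithm.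
Variable Q : quiver.
Implicit Types (d e a b : dimvec Q) (f g z : qseries Q).

Lemma coefD f g d : coef (f + g) d = coef f d + coef g d.
Proof. by []. Qed.

Lemma coefN f d : coef (- f) d = - coef f d.
Proof. by []. Qed.

Lemma coefZ (x : base_field) f d : coef (x *: f) d = x * coef f d.
Proof. by []. Qed.

Lemma coef_y a d : coef (y a) d = (a == d)%:R.
Proof. by []. Qed.

Lemma coef1 d : coef (1 : qseries Q) d = - (0 == d)%:R.
Proof. by []. Qed.

Lemma coefM f g d : coef (f * g) d = \sum_(p <- decomp d)
  - qhalf ^ (lambda p.1 p.2) * coef f p.1 * coef g p.2.
Proof. by []. Qed.

Lemma y0 : y (0 : dimvec Q) = - 1.
Proof. by apply: qseriesP => d; rewrite coefN coef1 opprK. Qed.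

Lemma yD a b : y (a + b) = - (qhalf ^ (- lambda a b) *: (y a * y b)).
Proof.
apply: qseriesP => d; rewrite coefN coefZ coefM coef_y.
case: eqVneq => [<-|dN].
  rewrite -[X in - (_ * X)]/(coef (qmul (y a) (y b)) (a + b)) coef_qmul_y.
  rewrite /= eqxx mulr1 mulrN opprK -expfzDr ?qhalf_neq0 //.
  by rewrite addNr expr0z.
rewrite big1_seq ?mulr0 ?oppr0 // => -[c e] /=; rewrite mem_decomp => /eqP /= E.
case: (eqVneq a c) => [ac|]; last by rewrite mulr0 mul0r.
case: (eqVneq b e) => [be|]; last by rewrite mulr0.
by case/eqP: dN; rewrite ac be.
Qed.

(* The value at [z] of the formal power series [\sum_k c k * z^k], for [z] with
   zero constant coefficient: the terms with [k > total_dim d] then do not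
   contribute to the coefficient at [d]. *)
Definition qeval (c : nat -> base_field) z : qseries Q :=
  QSeries (fun d => \sum_(k < (total_dim d).+1) c k * coef (z ^+ k) d).

Lemma coef_exp_eq0 z k d :
  coef z 0 = 0 -> (total_dim d < k)%N -> coef (z ^+ k) d = 0.
Proof.
move=> z0; elim: k d => [//|k IHk] d dk; rewrite exprS coefM.
rewrite big1_seq // => -[a b] /=; rewrite mem_decomp => /eqP /= E.
case: (eqVneq a 0) => [->|aN0]; first by rewrite z0 mulr0 mul0r.
rewrite IHk ?mulr0 //; move: dk; rewrite -E total_dimD ltnS; apply: leq_trans.
rewrite -add1n leq_add2r lt0n; apply: contra_neq aN0 => a0.
apply/ffunP => i; rewrite ffunE; apply/eqP; rewrite -leqn0 -a0.
exact: leq_total_dim.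
Qed.

Lemma coef_qeval c z d n : coef z 0 = 0 -> (total_dim d < n)%N ->
  coef (qeval c z) d = \sum_(k < n) c k * coef (z ^+ k) d.
Proof.
move=> z0 dn; rewrite /= -!(big_mkord xpredT (fun k => c k * coef (z ^+ k) d)).
rewrite [RHS](big_cat_nat (n := (total_dim d).+1)) //=.
rewrite [X in _ = _ + X]big_nat_cond [X in _ = _ + X]big1 ?addr0 // => k.
by case/andP=> /andP[dk _] _; rewrite coef_exp_eq0 ?mulr0.
Qed.

Definition qdilog_coef (k : nat) : base_field :=
  (- 1) ^+ k * qhalf ^+ (k ^ 2) / \prod_(1 <= j < k.+1) (1 - qvar ^+ j).

Definition qdilog z : qseries Q := qeval qdilog_coef z.

(* [s] is the labeling of the vertices. *)
Definition DT_invariant (s : seq (vert Q)) : qseries Q :=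
  \prod_(i <- s) qdilog (y (basis_dimvec i)).

End QuantumDilogarithm.

(* Main.v *)
From mathcomp Require Import all_boot all_order all_algebra.
From mathcomp Require Import fraction ring zify boolp.
Require Import Defs.
Import Order.TTheory GRing.Theory Num.Theory.
Local Open Scope ring_scope.

Set Implicit Arguments.
Unset Strict Implicit.
Unset Printing Implicit Defensive.

(** Write [E_Q] for the ordered product of the dilogarithms [E(y_(e_i))] over the
    vertices and [F_Q] for the one over the roots.  Two factors whose order is not
    forced by the hypotheses have [lambda = 0], so they commute; hence both products
    may be reordered freely within these constraints ([prod_perm_pairwise]).  An
    admissible partition has a topological order of its parts, and grouping the
    factors of both products by part in this order ([partition_factorization])
    reduces the theorem to a single Dynkin quiver: the parts are full subquivers, so
    the quantum algebra of a part embeds into that of [Q] by extension by zero.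

    For a Dynkin quiver the identity [E_Q = F_Q] is due to Reineke.  The proof here
    uses reflections at sinks instead of representations.  Let [k] be a sink, [Q']
    the reflected quiver and [E_k] the dilogarithm at [k].  The factor [E_k] can be
    placed last in [F_Q] and first in [E_Q], and first in [F_Q'] and last in
    [E_Q'].  Conjugation by [E_k] replaces [y_(e_i)], for an arrow from [i] to
    [k], by [y_(e_i) + y_(e_i + e_k)], and so does conjugation by [E_k^-1] in the
    algebra of [Q']; this is the functional equation of the dilogarithm.  The
    reflection [s_k] exchanges the two summands and permutes the positive roots
    other than [e_k], and it preserves [lambda].  Therefore the discrepancy
    [G_Q = F_Q^-1 E_Q] satisfies [G_Q' = s_k(E_k G_Q E_k^-1)]
    ([reflection_step]).

    Suppose that [G_Q] is not 1, and let [d] be an exponent of minimal height in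
    [G_Q - 1].  As long as [e_k] has positive height, conjugation by [E_k] only adds
    terms of larger height, so [s_k d] is again of minimal height in [G_Q' - 1], for
    the transported height.  Each reflection lowers the number of positive roots of
    positive height by one.  When no sink of positive height is left, all simple
    roots have negative height ([height_terminal]): the roots of negative height
    form a final segment of the Auslander-Reiten quiver, a property that is encoded
    by the sign of the Euler form ([height_separated]) and that reflections
    preserve.  Then the transported exponent, a nonzero dimension vector, has both
    positive and negative height, which is absurd ([no_minimal_discrepancy]).

    About the Dynkin types this uses only that the quiver is simply laced and that
    its Tits form is positive definite ([dynkin_tits_posdef]); the latter makes
    every reflected positive root other than [e_k] positive ([root_reflectable]). *)

(** * Reordering noncommutative products *)

(** If each factor that has to be moved past another one commutes with it, a
    product does not depend on the order.  The relation [r] records the order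
    that the two sequences respect: a pair listed in opposite orders satisfies
    both [r x y] and [r y x]. *)
Lemma prod_perm_pairwise (R : pzRingType) (T : eqType) (r : rel T) (F : T -> R)
    (s1 s2 : seq T) :
  perm_eq s1 s2 -> pairwise r s1 -> pairwise r s2 ->
  {in s1 &, forall x y, r x y -> r y x -> F x * F y = F y * F x} ->
  \prod_(x <- s1) F x = \prod_(x <- s2) F x.
Proof.
elim: s2 s1 => [|x s2 IHs] s1 s12 r1 /= r2 rC; first by rewrite (perm_nilP s12).
have xs1 : x \in s1 by rewrite (perm_mem s12) mem_head.
case/splitPr: xs1 s12 r1 rC => l t s12 r1 rC.
have {s12} lt2 : perm_eq (l ++ t) s2.
  by rewrite -(perm_cons x) -(permPr s12) -cat1s perm_catCA.
case/andP: r2 => x2 r2.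
move: r1; rewrite pairwise_cat /= => /and3P[lxt rl /andP[xt rt]].
have sub z : z \in l ++ t -> z \in l ++ x :: t.
  by rewrite !mem_cat inE => /orP[->|->] //; rewrite !orbT.
have IH : \prod_(z <- l ++ t) F z = \prod_(z <- s2) F z.
  apply: IHs => //; last by move=> z w /sub zi /sub wi; apply: rC.
  rewrite pairwise_cat rl rt !andbT; apply/allrelP => z w zl wt.
  by apply: (allrelP lxt) => //; rewrite inE wt orbT.
have lx : {in l, forall z, F z * F x = F x * F z}.
  move=> z zl; apply: rC; rewrite ?mem_cat ?zl ?mem_head ?orbT //.
    by apply: (allrelP lxt); rewrite ?mem_head.
  by apply: (allP x2); rewrite -(perm_mem lt2) mem_cat zl.
rewrite big_cons -IH !big_cat big_cons /= mulrA [RHS]mulrA; congr (_ * _).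
elim: l lx {s2 IHs lt2 x2 r2 rC lxt rl sub IH} => [_|z l IHl lx].
  by rewrite big_nil mul1r mulr1.
rewrite big_cons -mulrA IHl => [|w wl]; last by rewrite lx // inE wl orbT.
by rewrite mulrA lx ?mem_head // mulrA.
Qed.

(** * Formal series in the quantum algebra *)

Section Series.
Variable Q : quiver.
Implicit Types (d e a b : dimvec Q) (f g h z w : qseries Q) (x : base_field).

Lemma total_dim_eq0 d : (total_dim d == 0%N) = (d == 0).
Proof.
apply/eqP/eqP => [d0|->]; last by rewrite /total_dim big1 // => i; rewrite ffunE.
apply/ffunP => i; rewrite ffunE; apply/eqP; rewrite -leqn0 -d0.
exact: leq_total_dim.
Qed.

(** Coefficients below a given total dimension: an identity between products of
    evaluations of power series is checked on truncations, where it becomes an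
    identity between polynomials. *)
Definition eq_upto n f g := forall d, (total_dim d < n)%N -> coef f d = coef g d.

Lemma eq_uptoP f g : (forall n, eq_upto n f g) -> f = g.
Proof. by move=> fg; apply: qseriesP => d; apply: (fg (total_dim d).+1). Qed.

Lemma eq_upto_trans n g f h : eq_upto n f g -> eq_upto n g h -> eq_upto n f h.
Proof. by move=> fg gh d dn; rewrite fg ?gh. Qed.

Lemma eq_upto_sym n f g : eq_upto n f g -> eq_upto n g f.
Proof. by move=> fg d dn; rewrite fg. Qed.

Lemma eq_uptoM n f f' g g' :
  eq_upto n f f' -> eq_upto n g g' -> eq_upto n (f * g) (f' * g').
Proof.
move=> ff gg d dn; rewrite !coefM; apply: eq_big_seq => p.
rewrite mem_decomp => /eqP pd; rewrite -pd total_dimD in dn.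
by rewrite ff ?gg //; apply: leq_ltn_trans dn; rewrite ?leq_addr ?leq_addl.
Qed.

Lemma coef_sum (I : Type) (r : seq I) (P : pred I) (F : I -> qseries Q) d :
  coef (\sum_(i <- r | P i) F i) d = \sum_(i <- r | P i) coef (F i) d.
Proof. exact: (big_morph (fun f => coef f d)). Qed.

Lemma qeval_upto c z n : coef z 0 = 0 ->
  eq_upto n (qeval c z) (\sum_(k < n) c k *: z ^+ k).
Proof.
move=> z0 d dn; rewrite (coef_qeval _ z0 dn) coef_sum.
by apply: eq_bigr => k _.
Qed.

Lemma coefM0 f g : coef (f * g) 0 = - coef f 0 * coef g 0.
Proof.
rewrite coefM (bigD1_seq (0, 0)) ?mem_decomp ?decomp_uniq ?addr0 //=.
rewrite lambda0l expr0z mulN1r big_seq_cond big1 ?addr0 //.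
move=> [a b] /=; rewrite mem_decomp /= => /andP[/eqP ab].
suff [-> ->] : a = 0 /\ b = 0 by rewrite eqxx.
move/(congr1 (@total_dim Q)): ab; rewrite total_dimD.
move/eqP; have /eqP -> : total_dim (0 : dimvec Q) == 0%N by rewrite total_dim_eq0.
by rewrite addn_eq0 !total_dim_eq0 => /andP[/eqP -> /eqP ->].
Qed.

Lemma coef_qeval0 c z : coef (qeval c z) 0 = - c 0%N.
Proof.
have t0 : total_dim (0 : dimvec Q) = 0%N by apply/eqP; rewrite total_dim_eq0.
by rewrite /= t0 big_ord_recl big_ord0 expr0 coef1 eqxx mulrN1 addr0.
Qed.

(** Multiplication by a fixed series is continuous, so a relation
    [z * w = w * z'] extends from [z], [z'] to power series in them. *)
Lemma qeval_intertwine c z z' w : coef z 0 = 0 -> coef z' 0 = 0 ->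
  w * z = z' * w -> w * qeval c z = qeval c z' * w.
Proof.
move=> z0 z0' wz; apply: eq_uptoP => n.
apply: (@eq_upto_trans _ (w * \sum_(k < n) c k *: z ^+ k)).
  by apply: eq_uptoM => //; apply: qeval_upto.
apply: eq_upto_sym.
apply: (@eq_upto_trans _ ((\sum_(k < n) c k *: z' ^+ k) * w)).
  by apply: eq_uptoM => //; apply: qeval_upto.
suff -> : w * \sum_(k < n) c k *: z ^+ k = (\sum_(k < n) c k *: z' ^+ k) * w by [].
rewrite mulr_sumr mulr_suml; apply: eq_bigr => -[k _] _ /=.
rewrite -scalerAl -scalerAr; congr (_ *: _); elim: k => [|k IHk].
  by rewrite !expr0 mulr1 mul1r.
by rewrite exprSr mulrA IHk -mulrA wz mulrA -exprSr.
Qed.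

Lemma qeval_scale c x z : qeval c (x *: z) = qeval (fun k => c k * x ^+ k) z.
Proof.
apply: qseriesP => d /=; apply: eq_bigr => k _.
by rewrite exprZn coefZ mulrA.
Qed.

Lemma qeval_recl c z : coef z 0 = 0 ->
  qeval c z = (c 0%N)%:A + z * qeval (fun k => c k.+1) z.
Proof.
move=> z0; apply: eq_uptoP => n.
apply: (@eq_upto_trans _ (\sum_(k < n.+1) c k *: z ^+ k)).
  by move=> d dn; apply: qeval_upto => //; apply: ltnW.
apply: eq_upto_sym.
apply: (@eq_upto_trans _ ((c 0%N)%:A + z * \sum_(k < n) c k.+1 *: z ^+ k)).
  move=> d dn; rewrite !coefD; congr (_ + _).
  by apply: (@eq_uptoM n) => //; apply: qeval_upto.
rewrite big_ord_recl expr0 mulr_sumr; move=> d _; congr (coef (_ + _) d).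
by apply: eq_bigr => k _; rewrite -scalerAr -exprS.
Qed.

(** The inverse [\sum_k (1 - f) ^+ k] of a series with constant coefficient 1
    (that is, with [coef f 0 = -1], because [y 0 = - 1]). *)
Definition qinv f : qseries Q := qeval (fun=> 1) (1 - f).

Lemma qmulrV f : coef f 0 = - 1 -> f * qinv f = 1.
Proof.
move=> f0; have z0 : coef (1 - f) 0 = 0.
  by rewrite coefD coefN coef1 eqxx f0 subrr.
have := qeval_recl (fun=> 1) z0; rewrite -/(qinv f) scale1r.
by rewrite mulrBl mul1r addrA => /eqP; rewrite eq_sym subr_eq addrC => /eqP/addrI.
Qed.

Lemma qmulVr f : coef f 0 = - 1 -> qinv f * f = 1.
Proof.
move=> f0; rewrite -(qmulrV f0).
have z0 : coef (1 - f) 0 = 0.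
  by rewrite coefD coefN coef1 eqxx f0 subrr.
apply/esym/qeval_intertwine => //.
by rewrite mulrBl mulrBr mulr1 mul1r.
Qed.

End Series.

(** * The quantum dilogarithm *)

Lemma qvar_expr_neq1 k : (0 < k)%N -> 1 - qvar ^+ k != 0.
Proof.
case: k => // k _; rewrite /qvar /qhalf -exprM -tofracXn -tofrac1 -tofracB.
rewrite tofrac_eq0 subr_eq0 eq_sym.
apply/eqP => /(congr1 (fun p : {poly rat} => size p)).
by rewrite size_polyXn size_poly1 mul2n doubleS.
Qed.

Lemma qdilog_coef0 : qdilog_coef 0 = 1.
Proof. by rewrite /qdilog_coef !expr0 big_geq // divr1 mul1r. Qed.

Lemma qdilog_coefS k :
  qdilog_coef k.+1 * (1 - qvar ^+ k.+1) =
  - qdilog_coef k * qhalf ^+ (k.*2.+1).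
Proof.
rewrite /qdilog_coef big_nat_recr //= invfM.
have := qvar_expr_neq1 (ltn0Sn k); set u := 1 - _ => u0.
rewrite !mulrA mulfVK // exprS.
have -> : (k.+1 ^ 2 = k ^ 2 + k.*2.+1)%N by rewrite -addn1 sqrnD; lia.
by rewrite exprD; ring.
Qed.

Section Dilogarithm.
Variable Q : quiver.
Implicit Types (d e a b : dimvec Q) (f g h z w : qseries Q) (x : base_field).

Lemma qvar_neq0 : qvar != 0.
Proof. by rewrite expf_neq0 ?qhalf_neq0. Qed.

(** The functional equation [E(q^-1 z) = (1 - q^(-1/2) z) E(z)]: it turns the
    commutation of [y d] past a dilogarithm into a two-term expression, which is
    all that the reflections below need. *)
Lemma qdilog_functional z : coef z 0 = 0 ->
  qdilog (qvar^-1 *: z) = (1 - qhalf^-1 *: z) * qdilog z.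
Proof.
move=> z0; pose c k := qdilog_coef k * qvar ^- k - qdilog_coef k.
have cE : qdilog (qvar^-1 *: z) - qdilog z = qeval c z.
  rewrite /qdilog qeval_scale; apply: qseriesP => d /=.
  rewrite -sumrB; apply: eq_bigr => k _.
  by rewrite -mulrBl /c exprVn.
have cS k : c k.+1 = - qhalf^-1 * qdilog_coef k.
  have qk : qvar ^+ k.+1 != 0 by rewrite expf_neq0 ?qvar_neq0.
  have -> : c k.+1 = qdilog_coef k.+1 * (1 - qvar ^+ k.+1) / qvar ^+ k.+1.
    by rewrite /c mulrBr mulr1 mulrBl mulfK.
  apply: (mulIf qk); rewrite mulfVK // qdilog_coefS !mulNr; congr (- _).
  rewrite /qvar -exprM mulnS mul2n addnC addn2 [qhalf ^+ _.+2]exprS.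
  by rewrite mulrACA mulVf ?qhalf_neq0 // mul1r.
rewrite mulrBl mul1r -[LHS](subrK (qdilog z)) cE addrC; congr (_ + _).
rewrite (qeval_recl _ z0) {1}/c expr0 invr1 mulr1 subrr scale0r add0r.
transitivity (z * (- qhalf^-1 *: qdilog z)).
  congr (_ * _); apply: qseriesP => d /=; rewrite mulr_sumr.
  by apply: eq_bigr => k _; rewrite cS mulrA.
by rewrite -scalerAr scaleNr -scalerAl.
Qed.

Lemma y_mul a b : y a * y b = - (qhalf ^ lambda a b *: y (a + b)).
Proof.
rewrite yD scalerN opprK scalerA -expfzDr ?qhalf_neq0 //.
by rewrite subrr expr0z scale1r.
Qed.

Lemma coef_y0 a : a != 0 -> coef (y a) 0 = 0.
Proof. by move=> a0; rewrite coef_y (negPf a0). Qed.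

Lemma lambdaC a b : lambda b a = - lambda a b.
Proof.
rewrite /lambda exchange_big -sumrN; apply: eq_bigr => i _.
rewrite -sumrN; apply: eq_bigr => j _ /=; rewrite -mulrN opprB; ring.
Qed.

Lemma y_comm a b : lambda a b = 0 -> y a * y b = y b * y a.
Proof. by move=> ab; rewrite !y_mul (lambdaC a b) ab addrC. Qed.

Lemma qdilog_intertwine z z' w : coef z 0 = 0 -> coef z' 0 = 0 ->
  w * z = z' * w -> w * qdilog z = qdilog z' * w.
Proof. exact: qeval_intertwine. Qed.

Lemma qdilog_comm a b : a != 0 -> b != 0 -> lambda a b = 0 ->
  qdilog (y a) * qdilog (y b) = qdilog (y b) * qdilog (y a).
Proof.
move=> a0 b0 ab; apply: qdilog_intertwine; rewrite ?coef_y0 //.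
by apply/esym/qdilog_intertwine; rewrite ?coef_y0 // y_comm // lambdaC ab oppr0.
Qed.

Lemma y_qdilogl a d : a != 0 -> lambda d a = 1 ->
  qdilog (y a) * y d = (y d + y (d + a)) * qdilog (y a).
Proof.
move=> a0 da; have ya0 := coef_y0 a0.
have h0 := qhalf_neq0.
rewrite -(@qdilog_intertwine (qvar^-1 *: y a) _ (y d)) ?coefZ ?ya0 ?mulr0 //; last first.
  rewrite -scalerAr !y_mul (lambdaC d a) da addrC scalerN scalerA expr1z.
  by rewrite /qvar expr2 invfM mulfVK ?qhalf_neq0 // [qhalf ^ (-1)]exprN1.
rewrite (qdilog_functional ya0) mulrA mulrBr mulr1 -scalerAr y_mul da.
by rewrite scalerN opprK scalerA expr1z mulVf // scale1r.
Qed.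

Lemma y_qdilogr a d : a != 0 -> lambda a d = 1 ->
  y d * qdilog (y a) = qdilog (y a) * (y d + y (d + a)).
Proof.
move=> a0 da; have ya0 := coef_y0 a0.
have h0 := qhalf_neq0.
rewrite (@qdilog_intertwine _ (qvar^-1 *: y a)) ?coefZ ?ya0 ?mulr0 //; last first.
  rewrite -scalerAl !y_mul (lambdaC a d) da addrC scalerN scalerA expr1z.
  by rewrite /qvar expr2 invfM mulfVK ?qhalf_neq0 // [qhalf ^ (-1)]exprN1.
rewrite (qdilog_functional ya0) mulrBl mul1r -scalerAl.
have -> : y a * qdilog (y a) = qdilog (y a) * y a by apply: qdilog_intertwine.
rewrite mulrBl -scalerAl -mulrA y_mul da mulrN scalerN opprK -scalerAr scalerA expr1z.
by rewrite mulVf // scale1r mulrDr (addrC a).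
Qed.

Lemma coef_qdilog0 z : coef (qdilog z) 0 = - 1.
Proof. by rewrite coef_qeval0 qdilog_coef0. Qed.

Lemma coef_prod0 (T : Type) (s : seq T) (F : T -> qseries Q) :
  (forall i, coef (F i) 0 = - 1) -> coef (\prod_(i <- s) F i) 0 = - 1.
Proof.
move=> F0; elim/big_ind: _ => [|f g f0 g0|//].
  by rewrite coef1 eqxx.
by rewrite coefM0 f0 g0 opprK mul1r.
Qed.

(** ** Supports *)

Definition supported (C : pred (dimvec Q)) f := forall d, ~~ C d -> coef f d = 0.

Section Supported.
Variable C : pred (dimvec Q).
Hypotheses (C0 : C 0) (CD : forall a b, C a -> C b -> C (a + b)).

Lemma supported1 : supported C 1.
Proof.
by move=> d Cd; rewrite coef1; case: eqVneq Cd => [<-|]; rewrite ?C0 ?oppr0.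
Qed.

Lemma supported_y a : C a -> supported C (y a).
Proof. by move=> Ca d Cd; rewrite coef_y; case: eqVneq Cd => [<-|]; rewrite ?Ca. Qed.

Lemma supportedD f g : supported C f -> supported C g -> supported C (f + g).
Proof. by move=> Cf Cg d Cd; rewrite coefD Cf ?Cg ?addr0. Qed.

Lemma supportedN f : supported C f -> supported C (- f).
Proof. by move=> Cf d Cd; rewrite coefN Cf ?oppr0. Qed.

Lemma supportedM f g : supported C f -> supported C g -> supported C (f * g).
Proof.
move=> Cf Cg d; apply: contraNeq => fg.
have [p pd] : exists2 p, p \in decomp d & coef f p.1 != 0 /\ coef g p.2 != 0.
  apply: contrapT => H; case/eqP: fg; rewrite coefM big_seq big1 // => p pd.
  case: (eqVneq (coef f p.1) 0) => [->|f0]; first by rewrite mulr0 mul0r.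
  case: (eqVneq (coef g p.2) 0) => [->|g0]; first by rewrite mulr0.
  by case: H; exists p.
case=> fp gp; move: pd; rewrite mem_decomp => /eqP <-; apply: CD.
  by apply: contraNT fp => /Cf ->.
by apply: contraNT gp => /Cg ->.
Qed.

Lemma supported_exp f n : supported C f -> supported C (f ^+ n).
Proof.
move=> Cf; elim: n => [|n IHn]; first exact: supported1.
by rewrite exprS; apply: supportedM.
Qed.

Lemma supported_qeval c z : supported C z -> supported C (qeval c z).
Proof.
move=> Cz d Cd /=; rewrite big1 // => k _.
by rewrite supported_exp ?mulr0.
Qed.

Lemma supported_prod (T : eqType) (s : seq T) (F : T -> qseries Q) :
  {in s, forall i, supported C (F i)} -> supported C (\prod_(i <- s) F i).
Proof.
move=> CF; rewrite big_seq; elim/big_ind: _ => [|f g|i /CF //].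
  exact: supported1.
exact: supportedM.
Qed.

Lemma supported_qinv f : supported C f -> supported C (qinv f).
Proof.
move=> Cf; apply/supported_qeval/supportedD; first exact: supported1.
exact: supportedN.
Qed.

End Supported.

Lemma coef_qdilog_y b d : b != 0 -> coef (qdilog (y b)) d != 0 ->
  exists m, d = b *+ m.
Proof.
move=> b0; pose C d := `[< exists m, d = b *+ m >].
have CC : supported C (qdilog (y b)).
  apply: supported_qeval.
  - by apply/asboolP; exists 0%N.
  - move=> u v /asboolP[m ->] /asboolP[n ->]; apply/asboolP; exists (m + n)%N.
    by rewrite mulrnDr.
  - by apply: supported_y; apply/asboolP; exists 1%N.
move=> nz; apply/asboolP.
by move: nz; apply: contraNT => /CC ->.
Qed.

(** Conjugation by a series whose exponents have positive height does not affect
    the coefficients of minimal height. *)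
Lemma coef_intertwine_min (ht : dimvec Q -> int) (M : int) E g h :
  (forall a b, ht (a + b) = ht a + ht b) ->
  coef E 0 = - 1 -> (forall a, a != 0 -> coef E a != 0 -> 0 < ht a) ->
  E * g = h * E -> (forall d, ht d < M -> coef g d = 0) ->
  forall d, ht d <= M -> coef h d = coef g d.
Proof.
move=> htD E0 Epos Egh gM d.
have [n] := ubnP (total_dim d); elim: n d => // n IHn d dn dM.
have hM p : p.1 + p.2 = d -> p.2 != 0 -> coef E p.2 != 0 -> coef h p.1 = 0.
  move=> pd p0 /(Epos _ p0) Ep; have lt1 : ht p.1 < M.
    by apply: lt_le_trans dM; rewrite -pd htD ltrDl.
  rewrite IHn ?gM ?ltW // -ltnS; apply: leq_ltn_trans dn.
  rewrite -pd total_dimD.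
  by rewrite -[X in (X < _)%N]addn0 ltn_add2l lt0n total_dim_eq0.
move/(congr1 (fun f => coef f d)): Egh; rewrite !coefM.
rewrite (bigD1_seq (0, d)) ?mem_decomp ?decomp_uniq ?add0r //=.
rewrite [in RHS](bigD1_seq (d, 0)) ?mem_decomp ?decomp_uniq ?addr0 //=.
rewrite lambda0l lambda0r expr0z E0 mulrN1 opprK mul1r mulN1r mulrN1 opprK.
rewrite big_seq_cond big1 => [|[a b] /=]; last first.
  rewrite mem_decomp /= => /andP[/eqP ab ne].
  case: (eqVneq (coef E a) 0) => [->|Ea]; first by rewrite mulr0 mul0r.
  have a0 : a != 0.
    by apply: contra ne => /eqP a0; rewrite -ab a0 add0r.
  rewrite gM ?mulr0 //; apply: lt_le_trans dM.
  by rewrite -ab htD ltrDr Epos.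
rewrite big_seq_cond big1 => [|[a b] /=]; last first.
  rewrite mem_decomp /= => /andP[/eqP ab ne].
  case: (eqVneq (coef E b) 0) => [->|Eb]; first by rewrite mulr0.
  have b0 : b != 0.
    by apply: contra ne => /eqP b0; rewrite -ab b0 addr0.
  by rewrite (hM (a, b)) // mulr0 mul0r.
by rewrite !addr0.
Qed.
End Dilogarithm.

(** * Transport of series along a partial bijection of exponents *)

(** Reflections and extensions by zero both rename exponents in this way.  Since
    [lambda] is preserved, renaming is multiplicative ([pushM]) on series whose
    exponents lie in [C1]. *)
Record exponent_bij (Q1 Q2 : quiver) (C1 : pred (dimvec Q1))
    (C2 : pred (dimvec Q2)) (phi : dimvec Q1 -> dimvec Q2)
    (psi : dimvec Q2 -> dimvec Q1) : Prop := ExponentBij {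
  dom0 : C1 0;
  domD : forall a b, C1 a -> C1 b -> C1 (a + b);
  bijD : forall a b, C1 a -> C1 b -> phi (a + b) = phi a + phi b;
  bij_cod : forall a, C1 a -> C2 (phi a);
  inv_dom : forall a, C2 a -> C1 (psi a);
  bijK : forall a, C1 a -> psi (phi a) = a;
  invK : forall a, C2 a -> phi (psi a) = a;
  bij_lambda : forall a b, C1 a -> C1 b -> lambda (phi a) (phi b) = lambda a b
}.

Definition push (Q1 Q2 : quiver) (C2 : pred (dimvec Q2))
    (psi : dimvec Q2 -> dimvec Q1) (f : qseries Q1) : qseries Q2 :=
  QSeries (fun d => if C2 d then coef f (psi d) else 0).

Section Push.
Variables (Q1 Q2 : quiver) (C1 : pred (dimvec Q1)) (C2 : pred (dimvec Q2)).
Variables (phi : dimvec Q1 -> dimvec Q2) (psi : dimvec Q2 -> dimvec Q1).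
Hypothesis bij : exponent_bij C1 C2 phi psi.
Local Notation push := (push C2 psi).

Lemma push_phi f a : C1 a -> coef (push f) (phi a) = coef f a.
Proof. by move=> Ca; rewrite /= (bij_cod bij) // (bijK bij). Qed.

Lemma pushD f g : push (f + g) = push f + push g.
Proof. by apply: qseriesP => d; rewrite coefD /=; case: ifP; rewrite ?addr0. Qed.

Lemma phi_inj a b : C1 a -> C1 b -> phi a = phi b -> a = b.
Proof. by move=> Ca Cb ab; rewrite -(bijK bij Ca) ab (bijK bij). Qed.

Lemma push_y a : C1 a -> push (y a) = y (phi a).
Proof.
move=> Ca; apply: qseriesP => d; rewrite coef_y.
case: eqVneq => [<-|da]; first by rewrite push_phi // coef_y eqxx.
rewrite /=; case: ifP => // Cd; case: eqVneq => // ad.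
by case/eqP: da; rewrite ad (invK bij).
Qed.

Lemma bij0 : phi 0 = 0.
Proof.
have C0 := dom0 bij; apply: (@dimvec_addI Q2 (phi 0)).
by rewrite -(bijD bij) // !addr0.
Qed.

Lemma push1 : push 1 = 1.
Proof.
have -> : (1 : qseries Q1) = - y 0 by rewrite y0 opprK.
have -> : push (- y 0) = - push (y 0).
  by apply: qseriesP => d; rewrite coefN /=; case: ifP; rewrite ?oppr0.
by rewrite push_y ?(dom0 bij) // bij0 y0 opprK.
Qed.

Lemma pushM f g : supported C1 f -> supported C1 g ->
  push (f * g) = push f * push g.
Proof.
move=> Cf Cg; apply: qseriesP => d.
have C2D a b : C2 a -> C2 b -> C2 (a + b) /\ psi (a + b) = psi a + psi b.
  move=> Ca Cb; have [Ca' Cb'] := (inv_dom bij Ca, inv_dom bij Cb).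
  have CD := domD bij Ca' Cb'.
  have -> : a + b = phi (psi a + psi b) by rewrite (bijD bij) // !(invK bij).
  by rewrite (bijK bij) ?(bij_cod bij).
transitivity (\sum_(p <- decomp d | C2 p.1 && C2 p.2)
    - qhalf ^ lambda p.1 p.2 * coef f (psi p.1) * coef g (psi p.2)); last first.
  rewrite coefM big_mkcond; apply: eq_bigr => -[a b] _ /=.
  by case: (C2 a); case: (C2 b); rewrite ?mulr0 ?mul0r.
rewrite /=; case: ifP => Cd; last first.
  rewrite big_seq_cond big1 // => -[a b] /=; rewrite mem_decomp /=.
  by case/and3P=> /eqP ab Ca Cb; move: Cd; rewrite -ab (C2D _ _ Ca Cb).1.
transitivity (\sum_(p <- decomp (psi d) | C1 p.1 && C1 p.2)
    - qhalf ^ lambda p.1 p.2 * coef f p.1 * coef g p.2).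
  rewrite [RHS]big_mkcond; apply: eq_bigr => -[a b] _ /=.
  case: ifP => //; case Ca: (C1 a); last by rewrite Cf ?Ca // mulr0 mul0r.
  by case Cb: (C1 b) => // _; rewrite Cg ?Cb // mulr0.
rewrite -[LHS]big_filter -[RHS]big_filter.
set s1 := filter _ (decomp (psi d)); set s2 := filter _ (decomp d).
have -> : \sum_(p <- s2) - qhalf ^ lambda p.1 p.2 * coef f (psi p.1)
                         * coef g (psi p.2) =
          \sum_(p <- [seq (phi p.1, phi p.2) | p <- s1])
     - qhalf ^ lambda p.1 p.2 * coef f (psi p.1) * coef g (psi p.2).
  apply/perm_big/uniq_perm; first exact/filter_uniq/decomp_uniq.
    rewrite map_inj_in_uniq; first exact/filter_uniq/decomp_uniq.
    move=> -[a b] [a' b'].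
    rewrite !mem_filter /= => /andP[/andP[Ca Cb] _] /andP[/andP[Ca' Cb'] _].
    by case=> /phi_inj -> // /phi_inj ->.
  move=> [a b]; rewrite mem_filter mem_decomp /=.
  apply/idP/mapP => [/andP[/andP[Ca Cb] /eqP ab]|[[a' b']]].
    exists (psi a, psi b); last by rewrite /= !(invK bij).
    by rewrite mem_filter mem_decomp /= !(inv_dom bij) // -ab (C2D _ _ Ca Cb).2 eqxx.
  rewrite mem_filter mem_decomp /= => /andP[/andP[Ca Cb] /eqP ab] [-> ->].
  rewrite !(bij_cod bij) //= -(bijD bij) // ab (invK bij) //; exact: eqxx.
rewrite big_map; apply: eq_big_seq => -[a b]; rewrite mem_filter /=.
by case/andP=> /andP[Ca Cb] _; rewrite (bij_lambda bij) // !(bijK bij).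
Qed.

Lemma push_exp z n : supported C1 z -> push (z ^+ n) = push z ^+ n.
Proof.
move=> Cz; elim: n => [|n IHn]; first by rewrite !expr0 push1.
rewrite !exprS pushM ?IHn //.
by apply: supported_exp; [apply: dom0 bij | apply: domD bij |].
Qed.

Lemma coef_push0 z : coef (push z) 0 = coef z 0.
Proof. by rewrite -bij0 push_phi ?(dom0 bij). Qed.

Lemma push_qeval c z : supported C1 z -> coef z 0 = 0 ->
  push (qeval c z) = qeval c (push z).
Proof.
move=> Cz z0; apply: qseriesP => d.
have pz0 : coef (push z) 0 = 0 by rewrite coef_push0.
pose n := (maxn (total_dim d) (total_dim (psi d))).+1.
rewrite (@coef_qeval _ _ _ _ n pz0) ?ltnS ?leq_maxl //.
transitivity (if C2 d then coef (qeval c z) (psi d) else 0); first by [].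
rewrite (@coef_qeval _ _ _ _ n z0) ?ltnS ?leq_maxr //.
case: ifP => Cd; last first.
  by rewrite big1 // => k _; rewrite -push_exp //= Cd mulr0.
by apply: eq_bigr => k _; rewrite -push_exp //= Cd.
Qed.

Lemma push_prod (T : eqType) (s : seq T) (F : T -> qseries Q1) :
  {in s, forall i, supported C1 (F i)} ->
  push (\prod_(i <- s) F i) = \prod_(i <- s) push (F i).
Proof.
elim: s => [|i s IHs] CF; first by rewrite !big_nil push1.
have CFs : {in s, forall j, supported C1 (F j)}.
  by move=> j js; apply: CF; rewrite inE js orbT.
rewrite !big_cons pushM ?IHs //; first by apply: CF; rewrite mem_head.
by apply: supported_prod CFs; [apply: dom0 bij | apply: domD bij].
Qed.

Lemma push_qdilog_prod (T : eqType) (s : seq T) (F : T -> dimvec Q1) :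
  {in s, forall i, C1 (F i) /\ F i != 0} ->
  push (\prod_(i <- s) qdilog (y (F i))) = \prod_(i <- s) qdilog (y (phi (F i))).
Proof.
move=> sF; rewrite push_prod => [|i /sF[Ci _]]; last first.
  by apply/supported_qeval/supported_y => //; [apply: dom0 bij | apply: domD bij].
apply: eq_big_seq => i /sF[Ci i0]; rewrite push_qeval ?push_y ?coef_y0 //.
exact: supported_y.
Qed.

End Push.

(** * The Euler form and the roots *)

Definition loopless (Q : quiver) := forall i : vert Q, narrows i i = 0%N.

Definition sink (Q : quiver) (k : vert Q) := forall j : vert Q, narrows k j = 0%N.

Definition simply_laced (Q : quiver) := forall i j : vert Q, (narrows i j <= 1)%N.

Definition to_lattice (Q : quiver) (d : dimvec Q) : root_lattice Q :=
  [ffun i => (d i)%:Z].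

Section EulerForm.
Variable Q : quiver.
Implicit Types (i j k : vert Q) (a b c : root_lattice Q) (d e : dimvec Q).

Definition out_sum k b : int := \sum_j (narrows k j)%:Z * b j.
Definition in_sum k b : int := \sum_i (narrows i k)%:Z * b i.

Definition euler a b : int := \sum_i a i * (b i - out_sum i b).

Lemma euler_in_sum a b : euler a b = \sum_j (a j - in_sum j a) * b j.
Proof.
pose G i j : int := a i * ((narrows i j)%:Z * b j).
transitivity (\sum_i a i * b i - \sum_i \sum_j G i j).
  by rewrite -sumrB; apply: eq_bigr => i _; rewrite mulrBr mulr_sumr.
rewrite exchange_big -sumrB; apply: eq_bigr => j _.
rewrite mulrBl mulr_suml; congr (_ - _); apply: eq_bigr => i _.
by rewrite /G mulrCA mulrA.
Qed.

Lemma lambda_euler d e :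
  lambda d e = euler (to_lattice e) (to_lattice d) -
               euler (to_lattice d) (to_lattice e).
Proof.
rewrite euler_in_sum /euler -sumrB; apply: eq_bigr => i _.
rewrite !ffunE.
transitivity ((d i)%:Z * (out_sum i (to_lattice e) - in_sum i (to_lattice e))).
  rewrite /out_sum /in_sum -sumrB mulr_sumr; apply: eq_bigr => j _.
  by rewrite ffunE; ring.
by ring.
Qed.

Lemma sum_simple_root (F : vert Q -> int) k :
  \sum_i F i * simple_root k i = F k.
Proof.
rewrite (bigD1 k) //= ffunE eqxx mulr1 big1 ?addr0 // => i ik.
by rewrite ffunE eq_sym (negPf ik) mulr0.
Qed.

Lemma sum_sub_simple_root (F : vert Q -> int) b b' x k :
  (forall i, b' i = b i - x * simple_root k i) ->
  \sum_i F i * b' i = \sum_i F i * b i - x * F k.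
Proof.
move=> bE; rewrite mulrC -[F k * x](sum_simple_root (fun i => F i * x)) -sumrB.
by apply: eq_bigr => i _; rewrite bE mulrBr mulrA.
Qed.

Lemma out_sum_sub k b b' x j :
  (forall i, b' i = b i - x * simple_root j i) ->
  out_sum k b' = out_sum k b - x * (narrows k j)%:Z.
Proof. exact: sum_sub_simple_root. Qed.

Lemma in_sum_sub k b b' x j :
  (forall i, b' i = b i - x * simple_root j i) ->
  in_sum k b' = in_sum k b - x * (narrows j k)%:Z.
Proof. exact: sum_sub_simple_root. Qed.

Lemma euler_subl a a' b x k : (forall i, a' i = a i - x * simple_root k i) ->
  euler a' b = euler a b - x * (b k - out_sum k b).
Proof.
move=> aE; rewrite /euler.
rewrite (eq_bigr (fun i => (b i - out_sum i b) * a' i)) => [|i _].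
  rewrite (sum_sub_simple_root (fun i => b i - out_sum i b) aE).
  by congr (_ - _); apply: eq_bigr => i _; rewrite mulrC.
by rewrite mulrC.
Qed.

Lemma euler_subr a b b' x k : (forall i, b' i = b i - x * simple_root k i) ->
  euler a b' = euler a b - x * (a k - in_sum k a).
Proof.
by move=> bE; rewrite !euler_in_sum
     (sum_sub_simple_root (fun i => a i - in_sum i a) bE).
Qed.

Lemma euler0l b : euler 0 b = 0.
Proof. by rewrite /euler big1 // => i _; rewrite ffunE mul0r. Qed.

Lemma euler_simplel k b : euler (simple_root k) b = b k - out_sum k b.
Proof.
rewrite (@euler_subl 0 _ _ (-1) k) => [|i]; last by rewrite !ffunE; ring.
by rewrite euler0l; ring.
Qed.

Lemma euler_simpler a k : euler a (simple_root k) = a k - in_sum k a.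
Proof.
rewrite (@euler_subr a 0 _ (-1) k) => [|i]; last by rewrite !ffunE; ring.
by rewrite euler_in_sum big1 => [|i _]; [ring | rewrite ffunE mulr0].
Qed.

Lemma to_lattice_basis k : to_lattice (basis_dimvec k) = simple_root k.
Proof. by apply/ffunP => i; rewrite !ffunE. Qed.

Lemma to_lattice_inj : injective (@to_lattice Q).
Proof.
move=> d e /ffunP de; apply/ffunP => i.
by have := de i; rewrite !ffunE => -[].
Qed.

Lemma lambda_basis i j :
  lambda (basis_dimvec i) (basis_dimvec j) = (narrows i j)%:Z - (narrows j i)%:Z.
Proof.
rewrite lambda_euler !to_lattice_basis !euler_simplel !ffunE /out_sum.
by rewrite !sum_simple_root eq_sym; ring.
Qed.

(** The pairing of [b] with the simple coroot at [k]. *)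
Definition reflection_coef b k : int := \sum_i b i * cartan i k.

Lemma simple_reflectionE k b i :
  simple_reflection k b i = b i - reflection_coef b k * simple_root k i.
Proof. by rewrite ffunE. Qed.

Lemma nedgesE i j : i != j -> nedges i j = (narrows i j + narrows j i)%N.
Proof.
move=> ij; rewrite /nedges /narrows -cardsUI [X in (_ + X)%N]eq_card0 ?addn0.
  by apply: eq_card => a; rewrite !inE.
move=> a; rewrite !inE; apply/negP => /andP[/andP[/eqP ti _] /andP[/eqP tj _]].
by case/eqP: ij; rewrite -ti -tj.
Qed.

Definition tits_posdef := forall b, b != 0 -> 0 < euler b b.

Hypothesis ll : loopless Q.

Lemma reflection_coefE b k :
  reflection_coef b k = 2 * b k - in_sum k b - out_sum k b.
Proof.
rewrite /reflection_coef /in_sum /out_sum.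
rewrite (bigD1 k) //= [in RHS](bigD1 k) //= [X in _ = _ - _ - X](bigD1 k) //=.
rewrite !ll /cartan eqxx !mul0r !add0r mulrC -addrA -opprD -big_split /= -sumrN.
congr (_ + _); apply: eq_bigr => i ik; rewrite (negPf ik) nedgesE // PoszD.
by ring.
Qed.

Lemma tits_reflection b k :
  euler (simple_reflection k b) (simple_reflection k b) = euler b b.
Proof.
have sE := simple_reflectionE k b.
rewrite (euler_subl _ sE) (euler_subr _ sE) (out_sum_sub _ sE) ll sE ffunE eqxx.
by rewrite /= reflection_coefE; ring.
Qed.

Lemma tits_root b : is_root b -> euler b b = 1.
Proof.
elim=> [i|j {}b _ IHb]; last by rewrite tits_reflection.
by rewrite euler_simplel ffunE eqxx /out_sum sum_simple_root ll subr0.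
Qed.

End EulerForm.

(** * Reflection at a sink *)

Definition reflect (Q : quiver) (k : vert Q) : quiver :=
  @Quiver (vert Q) (arrow Q)
    (fun a => if hd a == k then k else tl a)
    (fun a => if hd a == k then tl a else hd a).

Section Reflection.
Variables (Q : quiver) (k : vert Q).
Hypotheses (ll : loopless Q) (kS : sink k).
Local Notation Q' := (reflect k).
Implicit Types (i j : vert Q) (a b c : root_lattice Q) (d e : dimvec Q).

Lemma sink_tl (a : arrow Q) : tl a != k.
Proof.
apply/eqP => ak; have /eqP := kS (hd a).
rewrite /narrows cards_eq0 => /eqP/setP/(_ a).
by rewrite !inE ak !eqxx.
Qed.

Lemma narrows_reflect i j :
  @narrows Q' i j =
  if i == k then narrows j k else if j == k then 0%N else narrows i j.
Proof.
rewrite /narrows; case: eqVneq => [->|ik]; last case: eqVneq => [->|jk].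
- apply: eq_card => a; rewrite !inE /=; case: (eqVneq (@hd Q a) k) => [hk|hk].
    by rewrite eqxx andbT.
  by rewrite (negPf (sink_tl a)) andbF.
- apply: eq_card0 => a; rewrite !inE /=; case: (eqVneq (@hd Q a) k) => [hk|hk].
    by rewrite eq_sym (negPf ik).
  by rewrite (negPf hk) andbF.
- apply: eq_card => a; rewrite !inE /=; case: (eqVneq (@hd Q a) k) => [->|//].
  by rewrite eq_sym (negPf ik) /= [k == j]eq_sym (negPf jk) andbF.
Qed.

Lemma loopless_reflect : loopless Q'.
Proof. by move=> i; rewrite narrows_reflect; case: eqP => [->|_]; rewrite ?ll. Qed.

Lemma simply_laced_reflect : simply_laced Q -> simply_laced Q'.
Proof. by move=> sl i j; rewrite narrows_reflect; case: ifP => // _; case: ifP. Qed.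

Lemma nedges_reflect i j : @nedges Q' i j = nedges i j.
Proof.
apply: eq_card => a; rewrite !inE /=; case: ifP => // /eqP ->.
by rewrite orbC [_ && (k == i)]andbC [_ && (k == j)]andbC.
Qed.

Lemma simple_reflection_reflect j b :
  @simple_reflection Q' j b = simple_reflection j b.
Proof.
apply/ffunP => i; rewrite !ffunE; congr (_ - _ * _); apply: eq_bigr => l _.
by rewrite /cartan nedges_reflect.
Qed.

Lemma is_root_reflect b : @is_root Q' b <-> is_root b.
Proof.
split; elim=> [i|j c _ IHc]; try exact: is_root_simple.
  by rewrite simple_reflection_reflect; apply: is_root_reflection.
by rewrite -simple_reflection_reflect; apply: (@is_root_reflection Q').
Qed.

Lemma out_sum_sink b : out_sum k b = 0.
Proof. by rewrite /out_sum big1 // => i _; rewrite kS mul0r. Qed.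

Lemma euler_reflectE a b :
  @euler Q' a b = euler a b + in_sum k a * b k - a k * in_sum k b.
Proof.
rewrite /euler (bigD1 k) //= [in RHS](bigD1 k) //= out_sum_sink.
have -> : @out_sum Q' k b = in_sum k b.
  apply: eq_bigr => i _; rewrite narrows_reflect eqxx //.
have inE : in_sum k a * b k = \sum_(i | i != k) a i * ((narrows i k)%:Z * b k).
  rewrite /in_sum (bigD1 k) //= ll mul0r add0r mulr_suml.
  by apply: eq_bigr => i _; ring.
have outE : \sum_(i | i != k) a i * (b i - @out_sum Q' i b) =
            \sum_(i | i != k) a i * (b i - out_sum i b) + in_sum k a * b k.
  rewrite inE -big_split; apply: eq_bigr => i ik /=.
  rewrite /out_sum (bigD1 k) //= narrows_reflect (negPf ik) eqxx mul0r add0r.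
  rewrite [in RHS](bigD1 k) //= (eq_bigr (fun j => (narrows i j)%:Z * b j)).
    by ring.
  by move=> j jk; rewrite narrows_reflect (negPf ik) (negPf jk).
by rewrite outE; ring.
Qed.

Lemma in_sum_reflection b : in_sum k (simple_reflection k b) = in_sum k b.
Proof. by rewrite (in_sum_sub _ (simple_reflectionE k b)) ll mulr0 subr0. Qed.

Lemma reflection_coef_sink b : reflection_coef b k = 2 * b k - in_sum k b.
Proof. by rewrite reflection_coefE // out_sum_sink subr0. Qed.

Lemma reflection_at_sink b : simple_reflection k b k = in_sum k b - b k.
Proof. by rewrite simple_reflectionE ffunE eqxx /= reflection_coef_sink; ring. Qed.

(** Reflection functors preserve the Euler form. *)
Lemma euler_reflect a b :
  @euler Q' (simple_reflection k a) (simple_reflection k b) = euler a b.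
Proof.
have sE := simple_reflectionE k.
rewrite euler_reflectE !in_sum_reflection !reflection_at_sink.
rewrite (euler_subl _ (sE a)) (euler_subr _ (sE b)) out_sum_sink.
rewrite reflection_at_sink !reflection_coef_sink.
by ring.
Qed.

Lemma simple_reflectionK : involutive (@simple_reflection Q k).
Proof.
move=> b; apply/ffunP => i; case: (eqVneq i k) => [->|ik].
  by rewrite !reflection_at_sink in_sum_reflection; ring.
by rewrite !simple_reflectionE ffunE [k == i]eq_sym (negPf ik) /=; ring.
Qed.

Lemma simple_reflection0 : simple_reflection k 0 = 0.
Proof.
apply/ffunP => i; rewrite simple_reflectionE /reflection_coef big1 => [|j _].
  by rewrite mul0r subr0.
by rewrite ffunE mul0r.
Qed.

(** ** Reflection of dimension vectors *)

Definition in_dim d : nat := (\sum_i narrows i k * d i)%N.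

Definition reflectable : pred (dimvec Q) := fun d => (d k <= in_dim d)%N.

Definition srefl d : dimvec Q :=
  [ffun i => if i == k then (in_dim d - d k)%N else d i].

Lemma in_dimZ d : (in_dim d)%:Z = in_sum k (to_lattice d).
Proof.
rewrite /in_dim (big_morph Posz PoszD (erefl 0)).
by apply: eq_bigr => i _; rewrite ffunE PoszM.
Qed.

Lemma to_lattice_srefl d : reflectable d ->
  to_lattice (srefl d) = simple_reflection k (to_lattice d).
Proof.
move=> dR; apply/ffunP => i; rewrite ffunE [srefl d i]ffunE.
case: (eqVneq i k) => [->|ik].
  by rewrite -subzn // in_dimZ reflection_at_sink ffunE.
by rewrite simple_reflectionE !ffunE [k == i]eq_sym (negPf ik) /=; ring.
Qed.

Lemma in_dim_srefl d : in_dim (srefl d) = in_dim d.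
Proof.
apply: eq_bigr => i _; rewrite ffunE; case: (eqVneq i k) => // ->.
by rewrite ll.
Qed.

Lemma reflectable_srefl d : reflectable (srefl d).
Proof. by rewrite /reflectable in_dim_srefl ffunE eqxx leq_subr. Qed.

Lemma sreflK d : reflectable d -> srefl (srefl d) = d.
Proof.
move=> dR; apply/ffunP => i; rewrite !ffunE in_dim_srefl.
by case: (eqVneq i k) => [->|//]; rewrite eqxx subKn.
Qed.

Lemma in_dimD d e : in_dim (d + e) = (in_dim d + in_dim e)%N.
Proof.
by rewrite /in_dim -big_split; apply: eq_bigr => i _; rewrite dimvec_addE mulnDr.
Qed.

Lemma reflectableD d e : reflectable d -> reflectable e -> reflectable (d + e).
Proof. by move=> dR eR; rewrite /reflectable in_dimD dimvec_addE leq_add. Qed.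

Lemma sreflD d e : reflectable d -> reflectable e ->
  srefl (d + e) = srefl d + srefl e.
Proof.
move=> dR eR; apply/ffunP => i; rewrite dimvec_addE !ffunE in_dimD.
case: (eqVneq i k) => // _; rewrite -[(d k + e k)%R]/(d k + e k)%N.
by rewrite /reflectable in dR eR; lia.
Qed.

Lemma lambda_srefl d e : reflectable d -> reflectable e ->
  @lambda Q' (srefl d) (srefl e) = lambda d e.
Proof.
move=> dR eR; rewrite !lambda_euler.
have tE (c : dimvec Q) : @to_lattice Q' c = to_lattice c by [].
by rewrite !tE !to_lattice_srefl // !euler_reflect.
Qed.

Lemma srefl_bij : @exponent_bij Q Q' reflectable reflectable srefl srefl.
Proof.
split; try exact: reflectableD; try exact: sreflD; try exact: sreflK;
  try exact: lambda_srefl; try by move=> *; apply: reflectable_srefl.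
by rewrite /reflectable ffunE.
Qed.

Lemma basis_not_reflectable : ~~ reflectable (basis_dimvec k).
Proof.
rewrite /reflectable /in_dim ffunE eqxx big1 // => i _; rewrite ffunE.
by case: eqP => [<-|_]; rewrite ?ll ?muln0.
Qed.

(** ** Positivity of reflected roots *)

Hypothesis posdef : tits_posdef Q.

(** If [s_k d] had a negative coefficient at [k], then splitting it into its
    positive and its negative part would make its Tits form at least 2. *)
Lemma root_reflectable d :
  positive_root d -> d != basis_dimvec k -> reflectable d.
Proof.
move=> dR dk; rewrite /reflectable leqNgt; apply/negP => lt_d.
set b := to_lattice d; set v := simple_reflection k b.
pose b0 : root_lattice Q := [ffun i => if i == k then 0 else b i].
have vk : v k <= -1.
  by rewrite /v reflection_at_sink -in_dimZ ffunE; lia.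
have vE i : v i = b0 i - (- v k) * simple_root k i.
  case: (eqVneq i k) => [->|ik].
    by rewrite [b0 k]ffunE [simple_root k k]ffunE !eqxx /=; ring.
  rewrite /v simple_reflectionE [b0 i]ffunE [simple_root k i]ffunE [k == i]eq_sym.
  by rewrite (negPf ik) /=; ring.
have t1 : euler v v = 1.
  by apply: tits_root => //; apply: is_root_reflection.
have b0k : b0 k = 0 by rewrite ffunE eqxx.
have inb0 : 0 <= in_sum k b0.
  apply: sumr_ge0 => i _; apply: mulr_ge0 => //; rewrite ffunE.
  by case: eqP => // _; rewrite ffunE.
have tE : euler v v = euler b0 b0 + v k ^+ 2 - v k * in_sum k b0.
  rewrite (euler_subl _ vE) (euler_subr _ vE) out_sum_sink b0k.
  by ring.
have b00 : b0 != 0.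
  apply/eqP => b00.
  have bE i : b i = (0 : root_lattice Q) i - (- b k) * simple_root k i.
    rewrite [(0 : root_lattice Q) i]ffunE [simple_root k i]ffunE [k == i]eq_sym.
    case: (eqVneq i k) => [->|ik] /=; first by ring.
    have := congr1 (fun c : root_lattice Q => c i) b00.
    rewrite /= [b0 i]ffunE (negPf ik) [(0 : root_lattice Q) i]ffunE => ->.
    by rewrite mulr0 subr0.
  have := tits_root ll dR; rewrite -/(to_lattice d) -/b.
  rewrite (euler_subl _ bE) euler0l out_sum_sink ffunE => dk1.
  have {dk1} dk1 : d k = 1%N by nia.
  case/eqP: dk; apply/to_lattice_inj; rewrite to_lattice_basis -/b.
  apply/ffunP => i; rewrite bE [b k]ffunE dk1 [(0 : root_lattice Q) i]ffunE.
  by ring.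
have := posdef b00; move: t1; rewrite tE; nia.
Qed.

Lemma posdef_reflect : tits_posdef Q'.
Proof.
move=> b b0; rewrite -[b](simple_reflectionK (b : root_lattice Q)) euler_reflect.
apply: posdef; apply: contra b0 => /eqP s0; apply/eqP.
by rewrite -[b](simple_reflectionK (b : root_lattice Q)) s0; apply: simple_reflection0.
Qed.

Lemma positive_root_srefl d : positive_root d -> d != basis_dimvec k ->
  [/\ positive_root (srefl d), srefl d != basis_dimvec k & reflectable d].
Proof.
move=> dR dk; have dC := root_reflectable dR dk; split => //.
  rewrite /positive_root -/(to_lattice (srefl d)) to_lattice_srefl //.
  exact: is_root_reflection.
apply: contra basis_not_reflectable => /eqP <-; exact: reflectable_srefl.
Qed.

End Reflection.

(** * Labelings and orderings of the positive roots *)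

Section Orderings.
Variable Q : quiver.
Implicit Types (i j k : vert Q) (d e : dimvec Q) (s : seq (vert Q)).

Definition arrows_backward s := pairwise (fun i j => narrows i j == 0%N) s.

Definition vertex_order s := [/\ uniq s, s =i predT & arrows_backward s].

Definition lambda_nneg : rel (dimvec Q) := fun d e => 0 <= lambda d e.

Definition root_order (phi : seq (dimvec Q)) :=
  [/\ uniq phi, forall d, d \in phi <-> positive_root d & pairwise lambda_nneg phi].

Lemma basis_dimvec_neq0 i : basis_dimvec i != 0.
Proof. by apply/eqP => /(congr1 (fun d : dimvec Q => d i)); rewrite !ffunE eqxx. Qed.

Lemma positive_root_basis i : positive_root (basis_dimvec i).
Proof.
rewrite /positive_root -/(to_lattice _) to_lattice_basis; exact: is_root_simple.
Qed.

Lemma positive_root_neq0 d : loopless Q -> positive_root d -> d != 0.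
Proof.
move=> ll dR; apply/eqP => d0; have := tits_root ll dR.
rewrite -/(to_lattice d); have -> : to_lattice d = 0.
  by rewrite d0; apply/ffunP => i; rewrite !ffunE.
by rewrite euler0l.
Qed.

Lemma vertex_order_index s i j : vertex_order s -> i != j ->
  narrows i j != 0%N -> (index j s < index i s)%N.
Proof.
case=> us sT /(pairwiseP i) sP ij; apply: contraR; rewrite -leqNgt leq_eqVlt.
have [si sj] : i \in s /\ j \in s by rewrite !sT.
case/predU1P => [/index_inj eij|]; first by rewrite (eij i si sj) eqxx in ij.
by move/sP; rewrite !inE !index_mem => /(_ si sj); rewrite !nth_index.
Qed.

Lemma prod_arrows_backward s s' : perm_eq s s' ->
  arrows_backward s -> arrows_backward s' ->
  \prod_(i <- s) qdilog (y (basis_dimvec i)) =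
  \prod_(i <- s') qdilog (y (basis_dimvec i)).
Proof.
move=> ss' sA sA'; apply: (prod_perm_pairwise ss' sA sA') => i j _ _.
move=> /eqP ij /eqP ji; apply: qdilog_comm; rewrite ?basis_dimvec_neq0 //.
by rewrite lambda_basis ij ji subrr.
Qed.

Lemma prod_lambda_nneg phi phi' : perm_eq phi phi' ->
  {in phi, forall d, d != 0} ->
  pairwise lambda_nneg phi -> pairwise lambda_nneg phi' ->
  \prod_(d <- phi) qdilog (y d) = \prod_(d <- phi') qdilog (y d).
Proof.
move=> pp' p0 pL pL'; apply: (prod_perm_pairwise pp' pL pL') => d e dp ep.
rewrite /lambda_nneg (lambdaC d e) oppr_ge0 => de ed.
by apply: qdilog_comm; rewrite ?p0 //; apply/eqP; rewrite eq_le de ed.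
Qed.

End Orderings.

Lemma prod_intertwine (R : pzRingType) (T : eqType) (s : seq T)
    (F G : T -> R) (w : R) :
  {in s, forall i, w * F i = G i * w} ->
  w * \prod_(i <- s) F i = (\prod_(i <- s) G i) * w.
Proof.
elim: s => [|i s IHs] FG; first by rewrite !big_nil mulr1 mul1r.
rewrite !big_cons mulrA FG ?mem_head // -!mulrA IHs // => j js.
by rewrite FG // inE js orbT.
Qed.

Section ReflectionStep.
Variables (Q : quiver) (k : vert Q).
Hypotheses (ll : loopless Q) (kS : sink k).
Local Notation Q' := (reflect k).
Local Notation ek := (basis_dimvec k).
Implicit Types (i j : vert Q) (d e : dimvec Q) (s : seq (vert Q)).

Lemma lambda_sink d : lambda d ek = (in_dim k d)%:Z.
Proof.
rewrite lambda_euler to_lattice_basis euler_simplel euler_simpler in_dimZ.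
by rewrite (out_sum_sink kS); ring.
Qed.

Lemma lambda_source d : @lambda Q' ek d = (in_dim k d)%:Z.
Proof.
rewrite lambda_euler [@to_lattice Q' ek]to_lattice_basis.
rewrite euler_simplel euler_simpler in_dimZ.
rewrite [@in_sum Q' _ _]big1 => [|i _]; last first.
  by rewrite narrows_reflect // eqxx kS if_same mul0r.
rewrite [@out_sum Q' _ _](eq_bigr (fun i => (narrows i k)%:Z * to_lattice d i)).
  by rewrite /in_sum; ring.
by move=> i _; rewrite narrows_reflect // eqxx.
Qed.

Lemma vertex_order_reflect s : vertex_order s ->
  @vertex_order Q' (rcons (rem k s) k).
Proof.
case=> us sT sA; have ks : k \in s by rewrite sT.
have sP : perm_eq s (rcons (rem k s) k).
  by rewrite (permPl (perm_to_rem ks)) -cats1 -[k :: _]cat1s perm_catC.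
split; first by rewrite -(perm_uniq sP).
  by move=> i; rewrite -(perm_mem sP) sT.
rewrite /arrows_backward pairwise_rcons; apply/andP; split.
  apply/allP => i ik; by rewrite narrows_reflect // eqxx kS if_same.
have: arrows_backward (rem k s) by apply: subseq_pairwise (rem_subseq _ _) sA.
apply: (sub_in_pairwise (P := mem (rem k s))); last exact/allP.
have ne i : i \in rem k s -> i != k by rewrite mem_rem_uniq // inE => /andP[].
by move=> i j /ne ik /ne jk; rewrite narrows_reflect // (negPf ik) (negPf jk).
Qed.

Lemma in_dim_basis i : in_dim k (basis_dimvec i) = narrows i k.
Proof.
rewrite /in_dim (bigD1 i) //= ffunE eqxx muln1 big1 ?addn0 // => j ji.
by rewrite ffunE eq_sym (negPf ji) muln0.
Qed.

Lemma reflectable_basis i : i != k -> reflectable k (basis_dimvec i).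
Proof. by move=> ik; rewrite /reflectable ffunE (negPf ik). Qed.

Lemma srefl_basis i : i != k -> narrows i k = 1%N ->
  srefl k (basis_dimvec i) = basis_dimvec i + ek.
Proof.
move=> ik n1; apply/ffunP => j; rewrite dimvec_addE !ffunE in_dim_basis n1.
rewrite (negPf ik) subn0 [k == j]eq_sym; case: (eqVneq j k) => [->|_].
  by rewrite (negPf ik).
by rewrite addn0.
Qed.

Lemma srefl_basis0 i : i != k -> narrows i k = 0%N ->
  srefl k (basis_dimvec i) = basis_dimvec i.
Proof.
move=> ik n0; apply/ffunP => j; rewrite !ffunE in_dim_basis n0 sub0n.
by case: (eqVneq j k) => [->|_//]; rewrite (negPf ik).
Qed.

Lemma positive_root_reflect d : @positive_root Q' d <-> positive_root d.
Proof. exact: is_root_reflect. Qed.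

Lemma root_order_reflect phi : tits_posdef Q -> root_order phi ->
  @root_order Q' (ek :: [seq srefl k d | d <- rem ek phi]).
Proof.
move=> pd [up phiP pL].
have remP d : d \in rem ek phi -> positive_root d /\ d != ek.
  by rewrite mem_rem_uniq // inE => /andP[dk /phiP].
have reflP d : d \in rem ek phi ->
    [/\ positive_root (srefl k d), srefl k d != ek & reflectable k d].
  by move=> /remP[]; apply: positive_root_srefl.
split.
- rewrite /= map_inj_in_uniq ?rem_uniq ?andbT //.
    by apply/mapP => -[d /reflP[_ + _]] dE; rewrite -dE eqxx.
  move=> d e /reflP[_ _ dR] /reflP[_ _ eR] de.
  by rewrite -(sreflK ll dR) de sreflK.
- move=> d; split.
    rewrite inE => /predU1P[->|/mapP[e /reflP[eR _ _] ->]].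
      by apply/positive_root_reflect/positive_root_basis.
    exact/positive_root_reflect.
  move=> /positive_root_reflect dR; rewrite inE.
  case: (eqVneq (d : dimvec Q) ek) => //= dk.
  have [dR' dk' dC] := positive_root_srefl ll kS pd dR dk.
  apply/mapP; exists (srefl k d); last by rewrite sreflK.
  by rewrite mem_rem_uniq // inE dk' phiP.
rewrite /= all_map pairwise_map; apply/andP; split.
  by apply/allP => d dp; rewrite /= /lambda_nneg lambda_source.
have: pairwise (@lambda_nneg Q) (rem ek phi).
  by apply: subseq_pairwise (rem_subseq _ _) pL.
apply: (sub_in_pairwise (P := mem (rem ek phi))); last exact/allP.
move=> d e /reflP[_ _ dR] /reflP[_ _ eR].
by rewrite /= /lambda_nneg lambda_srefl.
Qed.

(** The conjugate of [y e_i] by the dilogarithm of the sink. *)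
Definition conj_y i : qseries Q :=
  if narrows i k == 0%N then y (basis_dimvec i)
  else y (basis_dimvec i) + y (basis_dimvec i + ek).

Lemma reflectable_basisD i : i != k -> narrows i k != 0%N ->
  reflectable k (basis_dimvec i + ek).
Proof.
move=> ik nk; rewrite /reflectable in_dimD !in_dim_basis ll addn0.
by rewrite dimvec_addE !ffunE (negPf ik) eqxx lt0n.
Qed.

Lemma supported_conj_y i : i != k -> supported (reflectable k) (conj_y i).
Proof.
move=> ik; rewrite /conj_y; case: eqP => [_|/eqP nk].
  exact/supported_y/reflectable_basis.
apply: supportedD; apply: supported_y; first exact: reflectable_basis.
exact: reflectable_basisD.
Qed.

Lemma addr_basis_neq0 d i : d + basis_dimvec i != 0.
Proof.
apply/eqP => /(congr1 (fun e : dimvec Q => e i)).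
by rewrite dimvec_addE !ffunE eqxx addn1.
Qed.

Lemma coef_conj_y0 i : coef (conj_y i) 0 = 0.
Proof.
rewrite /conj_y; case: ifP => _; rewrite ?coefD !coef_y0 ?addr0 //.
- exact: basis_dimvec_neq0.
- exact: addr_basis_neq0.
- exact: basis_dimvec_neq0.
Qed.

Hypothesis sl : simply_laced Q.

Lemma narrows_eq1 i j : narrows i j != 0%N -> narrows i j = 1%N.
Proof. by have := sl i j; case: (narrows i j) => [|[|]]. Qed.

Lemma qdilog_conj_y i :
  qdilog (y ek) * qdilog (y (basis_dimvec i)) =
  qdilog (conj_y i) * qdilog (y ek).
Proof.
apply: qdilog_intertwine; first by rewrite coef_y0 ?basis_dimvec_neq0.
  exact: coef_conj_y0.
have lE : lambda (basis_dimvec i) ek = (narrows i k)%:Z.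
  by rewrite lambda_sink in_dim_basis.
rewrite /conj_y; case: eqP => [n0|/eqP /narrows_eq1 n1].
  apply/esym/qdilog_intertwine; rewrite ?coef_y0 ?basis_dimvec_neq0 //.
  by apply: y_comm; rewrite lE n0.
by apply: y_qdilogl; rewrite ?basis_dimvec_neq0 // lE n1.
Qed.

Local Notation push := (@push Q Q' (@reflectable Q k) (@srefl Q k)).

Lemma push_conj_y i : i != k ->
  push (conj_y i) =
  if narrows i k == 0%N then y (basis_dimvec i : dimvec Q')
  else y (basis_dimvec i : dimvec Q') + y (basis_dimvec i + ek : dimvec Q').
Proof.
move=> ik; have bij := srefl_bij ll kS.
rewrite /conj_y; case: eqP => [n0|/eqP nk].
  by rewrite (push_y bij) ?reflectable_basis // srefl_basis0.
have sE := srefl_basis ik (narrows_eq1 nk).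
rewrite pushD !(push_y bij) ?reflectable_basis ?reflectable_basisD //.
by rewrite -sE sreflK ?reflectable_basis // addrC.
Qed.

Lemma qdilog_push_conj_y i : i != k ->
  qdilog (y (ek : dimvec Q')) * qdilog (push (conj_y i)) =
  qdilog (y (basis_dimvec i : dimvec Q')) * qdilog (y (ek : dimvec Q')).
Proof.
move=> ik; have bij := srefl_bij ll kS.
apply: qdilog_intertwine; first by rewrite (coef_push0 bij) coef_conj_y0.
  by rewrite coef_y0 ?basis_dimvec_neq0.
apply: esym.
have lE : @lambda Q' ek (basis_dimvec i) = (narrows i k)%:Z.
  by rewrite lambda_source in_dim_basis.
rewrite push_conj_y //; case: eqP => [n0|/eqP /narrows_eq1 n1].
  apply: qdilog_intertwine; rewrite ?coef_y0 ?(@basis_dimvec_neq0 Q') //.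
  by apply: y_comm; rewrite (lambdaC (ek : dimvec Q')) lE n0 oppr0.
by apply: y_qdilogr; rewrite ?(@basis_dimvec_neq0 Q') // lE n1.
Qed.

(** With [E_k] the dilogarithm of the sink, [E_Q = B E_k] and [F_Q = A E_k], while
    [E_Q' = E_k T(B)] and [F_Q' = E_k T(A)] for the reflection [T] of series.  The
    discrepancies [G = F_Q^-1 E_Q] and [T(H)] of the two quivers are thus related
    by [H = A^-1 B = E_k G E_k^-1]; the support of [H] makes [T] applicable. *)
Lemma reflection_step s phi G : tits_posdef Q -> vertex_order s -> root_order phi ->
  \prod_(i <- s) qdilog (y (basis_dimvec i)) =
    (\prod_(d <- phi) qdilog (y d)) * G ->
  exists H, [/\ supported (reflectable k) H,
    qdilog (y ek) * G = H * qdilog (y ek) &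
    \prod_(i <- rcons (rem k s) k) qdilog (y (@basis_dimvec Q' i)) =
    (\prod_(d <- ek :: [seq srefl k d | d <- rem ek phi])
       qdilog (y (d : dimvec Q'))) * push H].
Proof.
move=> pd [us sT sA] [up phiP pL].
have bij := srefl_bij ll kS.
have [C0 CD] := (dom0 bij, domD bij).
have ks : k \in s by rewrite sT.
have kphi : ek \in phi by apply/phiP/positive_root_basis.
have phi0 : {in phi, forall d, d != 0}.
  by move=> d /phiP; apply: positive_root_neq0.
have remC d : d \in rem ek phi -> reflectable k d /\ d != 0.
  move=> dr; move: (dr); rewrite mem_rem_uniq // inE => /andP[dk dp].
  by split; [apply: root_reflectable => //; apply/phiP | apply: phi0].
have rems i : i \in rem k s -> i != k by rewrite mem_rem_uniq // inE => /andP[].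
pose A := \prod_(d <- rem ek phi) qdilog (y d).
pose B := \prod_(i <- rem k s) qdilog (conj_y i).
have AC : supported (reflectable k) A.
  apply: supported_prod => // d /remC[dC _].
  exact/supported_qeval/supported_y.
have BC : supported (reflectable k) B.
  apply: supported_prod => // i /rems ik.
  exact/supported_qeval/supported_conj_y.
have A0 : coef A 0 = -1.
  by apply: coef_prod0 => d; apply: coef_qdilog0.
have FE : \prod_(d <- phi) qdilog (y d) = A * qdilog (y ek).
  have phiE : perm_eq phi (rcons (rem ek phi) ek).
    by rewrite (permPl (perm_to_rem kphi)) -cats1 -[ek :: _]cat1s perm_catC.
  rewrite (prod_lambda_nneg phiE phi0 pL).
    by rewrite -cats1 big_cat big_seq1.
  rewrite pairwise_rcons; apply/andP; split.
    by apply/allP => d _; rewrite /lambda_nneg lambda_sink.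
  by apply: subseq_pairwise (rem_subseq _ _) pL.
have EE : \prod_(i <- s) qdilog (y (basis_dimvec i)) = B * qdilog (y ek).
  rewrite (prod_arrows_backward (perm_to_rem ks) sA).
    by rewrite big_cons; apply: prod_intertwine => i _; apply: qdilog_conj_y.
  apply/andP; split; first by apply/allP => i _; rewrite kS.
  by apply: subseq_pairwise (rem_subseq _ _) sA.
rewrite EE FE => BAG; exists (qinv A * B); split.
- by apply: supportedM => //; apply: supported_qinv.
- have AV : qinv A * A = 1 by apply: qmulVr.
  by rewrite -mulrA BAG !mulrA AV mul1r.
rewrite big_cons -cats1 big_cat big_seq1 /= big_map.
rewrite -(@prod_intertwine _ _ (rem k s) (fun i => qdilog (push (conj_y i)))).
  rewrite -mulrA; congr (_ * _).
  have -> : \prod_(i <- rem k s) qdilog (push (conj_y i)) = push B.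
    rewrite (push_prod bij) => [|i /rems ik].
      apply: eq_big_seq => i /rems ik.
      rewrite (push_qeval bij) ?coef_conj_y0 //; exact: supported_conj_y.
    exact/supported_qeval/supported_conj_y.
  rewrite -(push_qdilog_prod bij) // -(pushM bij) //; last first.
    by apply: supportedM => //; apply: supported_qinv.
  by rewrite mulrA qmulrV // mul1r.
by move=> i /rems; apply: qdilog_push_conj_y.
Qed.

End ReflectionStep.

(** * Heights *)

Section Height.
Variable Q : quiver.
Implicit Types (i j k : vert Q) (d e : dimvec Q) (b : root_lattice Q).
Implicit Types (c : vert Q -> int) (s : seq (vert Q)).

Definition height c d : int := \sum_i (d i)%:Z * c i.

Lemma heightD c d e : height c (d + e) = height c d + height c e.
Proof.
rewrite /height -big_split; apply: eq_bigr => i _ /=.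
by rewrite dimvec_addE PoszD mulrDl.
Qed.

Lemma heightMn c d n : height c (d *+ n) = height c d *+ n.
Proof.
elim: n => [|n IHn]; last by rewrite !mulrS heightD IHn.
by rewrite !mulr0n /height big1 // => i _; rewrite ffunE mul0r.
Qed.

Lemma height_basis c i : height c (basis_dimvec i) = c i.
Proof.
rewrite /height (bigD1 i) //= ffunE eqxx mul1r big1 ?addr0 // => j ji.
by rewrite ffunE eq_sym (negPf ji) mul0r.
Qed.

(** The transport of the height [c] along [s_k]: this is [c] composed with [s_k]. *)
Definition refl_height k c : vert Q -> int := fun i => c i - cartan i k * c k.

Lemma height_srefl k c d : loopless Q -> sink k -> reflectable k d ->
  height (refl_height k c) (srefl k d) = height c d.
Proof.
move=> ll kS dR; pose H b := \sum_i c i * b i.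
have HE d' : height c d' = H (to_lattice d').
  by apply: eq_bigr => i _; rewrite ffunE mulrC.
have sE := simple_reflectionE k.
rewrite HE -[to_lattice d](simple_reflectionK ll kS) -to_lattice_srefl //.
rewrite /H (sum_sub_simple_root c (sE _)) /reflection_coef mulr_suml -sumrB.
by apply: eq_bigr => i _; rewrite [to_lattice _ i]ffunE /refl_height; ring.
Qed.

Lemma refl_height_at k c : refl_height k c k = - c k.
Proof. by rewrite /refl_height /cartan eqxx; ring. Qed.

Definition height_generic c := forall d, positive_root d -> height c d != 0.

(** Roots of negative height never map to roots of positive height: the negative
    roots form the end of the Auslander-Reiten quiver.  This is the numerical
    shadow of that fact which survives reflections. *)
Definition height_separated c := forall a b : dimvec Q,
  positive_root a -> positive_root b -> height c a < 0 -> 0 < height c b ->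
  euler (to_lattice a) (to_lattice b) <= 0.

Hypotheses (ll : loopless Q) (sl : simply_laced Q).

Lemma to_latticeD d e i : to_lattice (d + e) i = (d i)%:Z + (e i)%:Z.
Proof. by rewrite ffunE dimvec_addE. Qed.

Lemma positive_root_edge i j : i != j -> narrows i j = 1%N -> narrows j i = 0%N ->
  positive_root (basis_dimvec i + basis_dimvec j).
Proof.
move=> ij n1 n0; rewrite /positive_root -/(to_lattice _).
have -> : to_lattice (basis_dimvec i + basis_dimvec j) =
          simple_reflection j (simple_root i).
  apply/ffunP => l; rewrite to_latticeD simple_reflectionE /reflection_coef.
  rewrite (bigD1 i) //= big1 => [|m mi].
    rewrite [simple_root i i]ffunE eqxx /cartan (negPf ij) nedgesE // n1 n0.
    by rewrite !ffunE /= addn0; ring.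
  by rewrite ffunE eq_sym (negPf mi) mul0r.
exact/is_root_reflection/is_root_simple.
Qed.

(** Induction along the labeling, for the stronger claim that all roots of positive
    height vanish at [i] too.  If there is an arrow from [i] to [j], then
    [e_i + e_j] is a root that does not vanish at [j], so its height is negative;
    as its Euler form with [e_i] is 1, the height of [e_i] is negative as well.
    For a root [b] of positive height the Euler form of [e_i] and [b] is then at
    most 0, and it equals [b i]. *)
Lemma height_terminal c s : vertex_order s ->
  height_generic c -> height_separated c ->
  (forall k, sink k -> c k <= 0) -> forall i, c i < 0.
Proof.
move=> sO gc sc cS i.
suff [] : c i < 0 /\
    forall b : dimvec Q, positive_root b -> 0 < height c b -> b i = 0%N by [].
have [n] := ubnP (index i s); elim: n i => // n IHn i; rewrite ltnS => leni.
have ci0 : c i != 0 by rewrite -height_basis gc //; apply: positive_root_basis.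
have IH j : i != j -> narrows i j != 0%N ->
    c j < 0 /\ forall b : dimvec Q, positive_root b -> 0 < height c b -> b j = 0%N.
  by move=> ij nij; apply: IHn; apply: leq_trans leni; apply: vertex_order_index.
have ci : c i < 0.
  rewrite lt_neqAle ci0 leNgt; apply/negP => ci.
  case: (boolP [forall j, narrows i j == 0%N]) => [/forallP iS|].
    by move: ci; rewrite ltNge cS // => j; apply/eqP/iS.
  rewrite negb_forall => /existsP[j nij].
  have ij : i != j by apply: contra nij => /eqP <-; rewrite ll.
  have [cj jV] := IH j ij nij.
  have nji : narrows j i = 0%N.
    apply/eqP; apply: contraT => nji; have := vertex_order_index sO ij nij.
    rewrite ltnNge ltnW //; apply: vertex_order_index => //; by rewrite eq_sym.
  have n1 := narrows_eq1 sl nij.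
  have aR := positive_root_edge ij n1 nji.
  have ha : height c (basis_dimvec i + basis_dimvec j) < 0.
    rewrite lt_neqAle gc // leNgt; apply/negP => /(jV _ aR).
    by rewrite dimvec_addE !ffunE eqxx addn1.
  have := sc _ _ aR (positive_root_basis i) ha; rewrite height_basis => /(_ ci).
  rewrite to_lattice_basis euler_simpler to_latticeD !ffunE eqxx [j == i]eq_sym.
  rewrite (negPf ij) /in_sum big1 // => l _; rewrite to_latticeD !ffunE.
  case: (eqVneq i l) => [<-|_]; first by rewrite ll mul0r.
  by case: (eqVneq j l) => [<-|_]; rewrite ?nji ?mul0r ?mulr0.
split=> // b bR hb; have := sc _ _ (positive_root_basis i) bR.
rewrite height_basis => /(_ ci hb).
rewrite to_lattice_basis euler_simplel ffunE /out_sum big1 => [|j _].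
  by rewrite subr0 => ?; lia.
case: (eqVneq (narrows i j) 0%N) => [->|nij]; first by rewrite mul0r.
have ij : i != j by apply: contra nij => /eqP <-; rewrite ll.
by have [_ /(_ b bR hb) bj] := IH j ij nij; rewrite ffunE bj mulr0.
Qed.

End Height.

Lemma height_generic_reflect (Q : quiver) (k : vert Q) (c : vert Q -> int) :
  loopless Q -> sink k -> tits_posdef Q ->
  height_generic c -> @height_generic (reflect k) (refl_height k c).
Proof.
move=> ll kS pd gc d /positive_root_reflect dR.
case: (eqVneq (d : dimvec Q) (basis_dimvec k)) => [->|dk].
  rewrite [height _ _](@height_basis (reflect k)) refl_height_at oppr_eq0.
  by rewrite -height_basis; apply/gc/positive_root_basis.
have [dR' dk' dC] := positive_root_srefl ll kS pd dR dk.
rewrite -(sreflK ll dC) [height _ _](height_srefl _ ll kS (reflectable_srefl k ll _)).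
exact: gc.
Qed.

Lemma height_separated_reflect (Q : quiver) (k : vert Q) (c : vert Q -> int) :
  loopless Q -> sink k -> tits_posdef Q -> 0 < c k ->
  height_separated c -> @height_separated (reflect k) (refl_height k c).
Proof.
move=> ll kS pd ck sc a b /positive_root_reflect aR
  /positive_root_reflect bR.
have hk : @height (reflect k) (refl_height k c) (basis_dimvec k) = - c k.
  by rewrite [height _ _](@height_basis (reflect k)) refl_height_at.
have tE (d : dimvec Q) : @to_lattice (reflect k) d = to_lattice d by [].
rewrite !tE.
case: (eqVneq (b : dimvec Q) (basis_dimvec k)) => [->|bk].
  by rewrite hk oppr_gt0 => _ /(lt_trans ck); rewrite ltxx.
have [bR' bk' bC] := positive_root_srefl ll kS pd bR bk.
rewrite -(sreflK ll bC) (to_lattice_srefl ll kS (reflectable_srefl k ll _)).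
rewrite [X in 0 < X](height_srefl _ ll kS (reflectable_srefl k ll _)).
case: (eqVneq (a : dimvec Q) (basis_dimvec k)) => [->|ak].
  move=> _ _; rewrite to_lattice_basis.
  rewrite euler_reflectE // euler_simplel out_sum_sink //.
  rewrite [in_sum k (simple_root k)]sum_simple_root ll in_sum_reflection //.
  by rewrite reflection_at_sink // !ffunE eqxx; lia.
have [aR' ak' aC] := positive_root_srefl ll kS pd aR ak.
rewrite -(sreflK ll aC) (to_lattice_srefl ll kS (reflectable_srefl k ll _)).
rewrite [X in X < 0](height_srefl _ ll kS (reflectable_srefl k ll _)).
by rewrite euler_reflect //; apply: sc.
Qed.

(** * The factorization for a simply laced quiver with positive definite form *)

(** Suppose that the discrepancy [G = F_Q^-1 E_Q] has a nontrivial term, and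
    follow one of minimal height while reflecting at sinks [k] with
    [height c e_k > 0].  It stays minimal and keeps its height, whereas each
    reflection lowers the number of roots of positive height.  At the end every
    dimension vector has nonpositive height. *)
Lemma no_minimal_discrepancy n (Q : quiver) (s : seq (vert Q))
    (phi : seq (dimvec Q)) (c : vert Q -> int) (G : qseries Q) (d : dimvec Q) :
  loopless Q -> simply_laced Q -> tits_posdef Q ->
  vertex_order s -> root_order phi ->
  height_generic c -> height_separated c ->
  (count (fun a => (0 < height c a)%R) phi < n)%N ->
  \prod_(i <- s) qdilog (y (basis_dimvec i)) =
    (\prod_(a <- phi) qdilog (y a)) * G ->
  0 < height c d -> coef (G - 1) d != 0 ->
  (forall e, height c e < height c d -> coef (G - 1) e = 0) -> False.
Proof.
elim: n Q s phi c G d => // n IHn Q s phi c G d ll sl pd sO pO gc sc cnt EG d0 Gd dmin.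
have [[k kS ck]|noS] := pselect (exists2 k : vert Q, sink k & 0 < c k); last first.
  have c0 : forall i, c i < 0.
    apply: (height_terminal ll sl sO gc sc) => k kS.
    by rewrite leNgt; apply/negP => ck; apply: noS; exists k.
  move: d0; rewrite ltNge /height sumr_le0 // => i _.
  by rewrite mulr_ge0_le0 // ltW.
have [up phiP _] := pO.
have kphi : basis_dimvec k \in phi by apply/phiP/positive_root_basis.
have [H [HC GH EG']] := reflection_step ll kS sl pd sO pO EG.
have bij := srefl_bij ll kS.
have HGd : forall e, height c e <= height c d -> coef (H - 1) e = coef (G - 1) e.
  apply: (coef_intertwine_min (E := qdilog (y (basis_dimvec k)))) => //.
  - exact: heightD.
  - exact: coef_qdilog0.
  - move=> a a0 /(coef_qdilog_y (basis_dimvec_neq0 k))[m aE].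
    rewrite aE heightMn height_basis pmulrn_lgt0 // lt0n.
    by apply: contra a0 => /eqP m0; rewrite aE m0.
  by rewrite mulrBl mulrBr mulr1 mul1r GH.
pose T := @push Q (reflect k) (@reflectable Q k) (@srefl Q k).
have HT : T H - 1 = T (H - 1).
  have T1 : T 1 = 1 by exact: (push1 bij).
  have -> : T H = T (H - 1) + T 1 by rewrite /T -pushD subrK.
  by rewrite T1 addrK.
have H1C : supported (reflectable k) (H - 1).
  apply: supportedD => //; apply: supportedN.
  by apply: supported1; apply: (dom0 bij).
have dC : reflectable k d.
  by apply: contraNT Gd => dC; rewrite -HGd // H1C.
have hE e : reflectable k e ->
    @height (reflect k) (refl_height k c) (srefl k e) = height c e.
  exact: height_srefl.
(* [srefl k d] is a minimal exponent of the discrepancy of the reflected quiver. *)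
apply: (IHn (reflect k) _ _ (refl_height k c) _ (srefl k d) _ _ _ _ _ _ _ _ EG').
- exact: loopless_reflect.
- exact: simply_laced_reflect.
- exact: posdef_reflect.
- exact: vertex_order_reflect.
- exact: root_order_reflect.
- exact: height_generic_reflect.
- exact: height_separated_reflect.
- rewrite /= [height _ _](@height_basis (reflect k)) refl_height_at.
  rewrite oppr_gt0 ltNge (ltW ck) add0n count_map.
  rewrite (@eq_in_count _ _ (fun a => 0 < height c a)) => [|a].
    rewrite -ltnS (leq_ltn_trans _ cnt) // count_rem kphi /= height_basis ck.
    rewrite subn1 ltn_predL -has_count; apply/hasP; exists (basis_dimvec k) => //.
    by rewrite height_basis.
  rewrite mem_rem_uniq // inE => /andP[ak /phiP aR] /=; rewrite hE //.
  exact: root_reflectable.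
- by rewrite hE.
- change (coef (T H - 1) (srefl k d) != 0); rewrite HT.
  have -> : coef (T (H - 1)) (srefl k d) = coef (H - 1) d by exact: (push_phi bij).
  by rewrite HGd.
move=> e; rewrite hE // => he; change (coef (T H - 1) e = 0); rewrite HT.
change ((if reflectable k (e : dimvec Q) then coef (H - 1) (srefl k e) else 0) = 0).
case: ifP => // eC.
have he' : height c (srefl k e) < height c d.
  by rewrite -hE ?reflectable_srefl // sreflK.
by rewrite HGd ?ltW // dmin.
Qed.

(** Reineke's factorization.  For the total dimension every positive root has
    positive height, so the previous lemma applies to an exponent of least total
    dimension in the discrepancy. *)
Theorem root_factorization (Q : quiver) (s : seq (vert Q))
    (phi : seq (dimvec Q)) :
  loopless Q -> simply_laced Q -> tits_posdef Q ->
  vertex_order s -> root_order phi ->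
  \prod_(i <- s) qdilog (y (basis_dimvec i)) = \prod_(d <- phi) qdilog (y d).
Proof.
move=> ll sl pd sO pO; set E := LHS; set F := RHS.
have F0 : coef F 0 = - 1 by apply: coef_prod0 => d; apply: coef_qdilog0.
pose G := qinv F * E.
have EG : E = F * G by rewrite mulrA qmulrV // mul1r.
suff G1 : G = 1 by rewrite EG G1 mulr1.
apply: contrapT => Gne.
have [d Gd] : exists d, coef (G - 1) d != 0.
  apply: contrapT => H; apply: Gne; apply/eqP; rewrite -subr_eq0; apply/eqP.
  apply: qseriesP => d; apply/eqP; apply: contrapT => /negP Gd; apply: H.
  by exists d.
pose c (_ : vert Q) : int := 1.
have hE e : height c e = (total_dim e)%:Z.
  rewrite /total_dim (big_morph Posz PoszD (erefl 0)).
  by apply: eq_bigr => i _; rewrite mulr1.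
have exd : exists n, `[< exists2 e, total_dim e = n & coef (G - 1) e != 0 >].
  by exists (total_dim d); apply/asboolP; exists d.
have [n /asboolP[e en Ge] nmin] := ex_minnP exd.
have G0 : coef (G - 1) 0 = 0.
  have E0 : coef E 0 = - 1 by apply: coef_prod0 => i; apply: coef_qdilog0.
  have c1 : coef (1 : qseries Q) 0 = - 1 by rewrite coef1 eqxx.
  by rewrite coefD coefN c1 /G coefM0 E0 coef_qeval0 !opprK mul1r addNr.
have e0 : 0 < height c e.
  rewrite hE ltz_nat lt0n total_dim_eq0.
  by apply: contraNneq Ge => ->; rewrite G0.
have hpos f : positive_root f -> 0 < height c f.
  by move/(positive_root_neq0 ll) => f0; rewrite hE ltz_nat lt0n total_dim_eq0.
apply: (@no_minimal_discrepancy (count (fun a => (0 < height c a)%R) phi).+1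
  Q s phi c G e) => //.
- by move=> f /hpos; rewrite lt0r => /andP[].
- by move=> a b /hpos ha _ ha'; have := lt_trans ha ha'; rewrite ltxx.
move=> f; rewrite !hE en ltz_nat => fn; apply/eqP; apply: contraLR fn => Gf.
by rewrite -leqNgt; apply: nmin; apply/asboolP; exists f.
Qed.

(** * Positivity of the Tits form of a Dynkin diagram *)

(** The contribution to the Tits form of an arm of [a] nodes attached to the
    node [x a]. *)
Definition arm (x : nat -> int) (a : nat) : int :=
  \sum_(i < a) (x i ^+ 2 - x i * x i.+1).

Lemma armS x a : arm x a.+1 = arm x a + (x a ^+ 2 - x a * x a.+1).
Proof. by rewrite /arm big_ord_recr. Qed.

(** Completing squares from the free end of the arm. *)
Lemma arm_bound x a : 0 <= (2 * a.+1)%:Z * arm x a + a%:Z * x a ^+ 2.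
Proof.
elim: a => [|a IHa]; first by rewrite /arm big_ord0 mulr0 mul0r.
rewrite armS; set A := arm x a in IHa *; set u := x a in IHa *; set v := x a.+1.
have sq : 0 <= ((a%:Z + 2) * u - (a%:Z + 1) * v) ^+ 2 by exact: sqr_ge0.
have a0 : (0 : int) <= a%:Z by [].
suff : 0 <= (a%:Z + 1) * ((2 * a.+2)%:Z * (A + (u ^+ 2 - u * v)) + a.+1%:Z * v ^+ 2).
  by rewrite pmulr_rge0 //; lia.
have -> : (a%:Z + 1) * ((2 * a.+2)%:Z * (A + (u ^+ 2 - u * v)) + a.+1%:Z * v ^+ 2) =
  (a%:Z + 2) * ((2 * a.+1)%:Z * A + a%:Z * u ^+ 2) +
  ((a%:Z + 2) * u - (a%:Z + 1) * v) ^+ 2.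
  have -> : (2 * a.+2)%:Z = 2 * (a%:Z + 2) by lia.
  have -> : (2 * a.+1)%:Z = 2 * (a%:Z + 1) by lia.
  have -> : a.+1%:Z = a%:Z + 1 by lia.
  by ring.
by apply: addr_ge0 => //; apply: mulr_ge0 => //; lia.
Qed.

Lemma arm_eq0 x a : arm x a <= 0 -> x a = 0 -> forall i, (i <= a)%N -> x i = 0.
Proof.
elim: a => [|a IHa]; first by move=> _ x0 i; rewrite leqn0 => /eqP ->.
rewrite armS => A0 xa1; rewrite xa1 mulr0 subr0 in A0.
have B := arm_bound x a.
have xa : x a = 0.
  apply/eqP; rewrite -sqrf_eq0; apply/eqP.
  have := sqr_ge0 (x a); move: A0 B; set A := arm x a; set u := x a ^+ 2.
  move: A u => A u A0 B u0; nia.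
move=> i; rewrite leq_eqVlt => /predU1P[-> //|]; rewrite ltnS; apply: IHa => //.
by rewrite xa expr0n addr0 in A0.
Qed.

Lemma dynkin_link_irrefl T i : dynkin_valid T -> (i < dynkin_rank T)%N ->
  dynkin_link T i i = false.
Proof. by case: T => n /= nv iv; try case: eqP => ?; lia. Qed.

Lemma dynkin_link_antisym T i j : dynkin_valid T ->
  (i < dynkin_rank T)%N -> (j < dynkin_rank T)%N ->
  dynkin_link T i j && dynkin_link T j i = false.
Proof. by case: T => n /= nv iv jv; do ?case: eqP => ?; lia. Qed.

(** The Tits form in the numbering of the nodes. *)
Definition dynkin_form (T : dynkin_type) (x : nat -> int) : int :=
  \sum_(i < dynkin_rank T) x i ^+ 2 -
  \sum_(i < dynkin_rank T) \sum_(j < dynkin_rank T)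
     (dynkin_link T i j)%:Z * (x i * x j).

Lemma sum_link (n i : nat) (F : nat -> int) :
  \sum_(j < n) (i.+1 == j)%:Z * F j = if (i.+1 < n)%N then F i.+1 else 0.
Proof.
case: ltnP => [lt_i|ge_i].
  rewrite (bigD1 (Ordinal lt_i)) //= eqxx mul1r big1 ?addr0 // => j ji.
  case: eqP => [ij|]; last by rewrite mul0r.
  by case/eqP: ji; apply: val_inj.
rewrite big1 // => j _; case: eqP => [ij|]; last by rewrite mul0r.
by move: (ltn_ord j); rewrite -ij ltnNge ge_i.
Qed.

Lemma arm_path x n : x n = 0 ->
  arm x n = \sum_(i < n) x i ^+ 2 -
            \sum_(i < n) \sum_(j < n) (i.+1 == j)%:Z * (x i * x j).
Proof.
move=> xn; rewrite /arm sumrB; congr (_ - _); apply: eq_bigr => i _.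
rewrite (sum_link n i (fun j => x i * x j)); case: ltnP => // ni.
have -> : i.+1 = n by apply/eqP; rewrite eqn_leq ltn_ord ni.
by rewrite xn mulr0.
Qed.

Lemma dynkin_form_A n x : x n = 0 -> dynkin_form (TypeA n) x = arm x n.
Proof. by move=> xn; rewrite arm_path. Qed.

(** Types D and E: a path of [n] nodes with an extra node attached at [p]. *)
Lemma dynkin_form_branch T n p x z : dynkin_rank T = n.+1 -> (p < n)%N ->
  (forall i j, dynkin_link T i j = if j == n then i == p else i.+1 == j) ->
  {in gtn n, z =1 x} -> z n = 0 ->
  dynkin_form T x = arm z n + x n ^+ 2 - x p * x n.
Proof.
move=> rT pn lE zx zn; rewrite /dynkin_form rT arm_path //.
have zE (i : 'I_n) : z i = x i by rewrite zx ?inE.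
rewrite big_ord_recr /=.
have -> : \sum_(i < n.+1) \sum_(j < n.+1) (dynkin_link T i j)%:Z * (x i * x j) =
   \sum_(i < n) \sum_(j < n) (i.+1 == j)%:Z * (z i * z j) + x p * x n.
  transitivity (\sum_(i < n.+1) (\sum_(j < n) (i.+1 == j)%:Z * (x i * x j) +
                (val i == p)%:Z * (x i * x n))).
    apply: eq_bigr => i _; rewrite big_ord_recr /= lE eqxx; congr (_ + _).
    by apply: eq_bigr => j _; rewrite lE (ltn_eqF (ltn_ord j)).
  rewrite big_split /=; congr (_ + _).
    rewrite big_ord_recr /= [X in _ + X]big1 ?addr0 => [|j _].
      by apply: eq_bigr => i _; apply: eq_bigr => j _; rewrite !zE.
    by rewrite gtn_eqF ?mul0r // ltnS ltnW.
  have pn' : (p < n.+1)%N by rewrite ltnW.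
  rewrite (bigD1 (Ordinal pn')) //= eqxx mul1r big1 ?addr0 // => i ip.
  case: eqP => [ei|]; last by rewrite mul0r.
  by case/eqP: ip; apply: val_inj.
rewrite (eq_bigr (fun i : 'I_n => z i ^+ 2)) => [|i _]; last by rewrite zE.
by ring.
Qed.

(** Cutting a path at the node [p]: the second arm is read from its free end. *)
Lemma arm_split z p r : z (p + r).+1 = 0 ->
  arm z (p + r).+1 = arm z p + z p ^+ 2 + arm (fun i => z (p + r - i)%N) r.
Proof.
move=> z0; pose f i : int := z i ^+ 2 - z i * z i.+1.
have -> : arm z (p + r).+1 = arm z p + \sum_(j < r.+1) f (p + j)%N.
  by rewrite /arm -addnS big_split_ord.
rewrite -addrA; congr (_ + _); rewrite /f sumrB.
rewrite big_ord_recl /= addn0 [X in _ - X]big_ord_recr /= z0 mulr0 addr0 -addrA.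
congr (_ + _); rewrite /arm [in RHS](reindex_inj rev_ord_inj) /= -sumrB.
apply: eq_bigr => -[i ir] _ /=; rewrite /bump /= add1n addnS.
have -> : (p + r - (r - i.+1) = (p + i).+1)%N by lia.
have -> : (p + r - (r - i.+1).+1 = p + i)%N by lia.
by ring.
Qed.

(** A node [p] with arms of [p], [r] and 1 nodes.  The condition amounts to
    [1 / (p + 1) + 1 / (r + 1) + 1 / 2 > 1], which says that the diagram is of
    finite type. *)
Lemma branch_form_posdef z v p r : ((p%:Z - 1) * (r%:Z - 1) < 4 :> int) ->
  z (p + r).+1 = 0 -> arm z (p + r).+1 + v ^+ 2 - z p * v <= 0 ->
  v = 0 /\ forall i, (i <= p + r)%N -> z i = 0.
Proof.
move=> pr z0; rewrite arm_split //.
pose z' i := z (p + r - i)%N; rewrite -/z'.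
have z'r : z' r = z p by rewrite /z' addnK.
have [BA BB] := (arm_bound z p, arm_bound z' r); rewrite z'r in BB.
have [EA EB] := (@arm_eq0 z p, @arm_eq0 z' r); rewrite z'r in EB.
move: BA BB EA EB; set A := arm z p; set B := arm z' r; set w := z p.
move=> BA BB EA EB q0.
have w0 : w ^+ 2 <= 0.
  pose a : int := p%:Z + 1; pose b : int := r%:Z + 1.
  have [a0 b0] : 0 < a /\ 0 < b by clear; lia.
  have h1 : 0 <= 2 * b * ((2 * p.+1)%:Z * A + p%:Z * w ^+ 2).
    by apply: mulr_ge0 => //; clear -b0; lia.
  have h2 : 0 <= 2 * a * ((2 * r.+1)%:Z * B + r%:Z * w ^+ 2).
    by apply: mulr_ge0 => //; clear -a0; lia.
  have h3 : 0 <= a * b * (2 * v - w) ^+ 2.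
    by apply: mulr_ge0; [apply/ltW/mulr_gt0 | apply: sqr_ge0].
  have h4 : 4 * a * b * (A + w ^+ 2 + B + v ^+ 2 - w * v) <= 0.
    by rewrite pmulr_rle0 // !mulr_gt0.
  (* Completing the squares in both arms and in [v], multiplied by
     [4 (p + 1) (r + 1)], leaves this coefficient at [w ^+ 2]. *)
  have c0 : 0 < 4 - (p%:Z - 1) * (r%:Z - 1) by rewrite subr_gt0.
  rewrite -(pmulr_rle0 _ c0).
  have -> : (4 - (p%:Z - 1) * (r%:Z - 1)) * w ^+ 2 =
    4 * a * b * (A + w ^+ 2 + B + v ^+ 2 - w * v)
    - (2 * b * ((2 * p.+1)%:Z * A + p%:Z * w ^+ 2)
     + 2 * a * ((2 * r.+1)%:Z * B + r%:Z * w ^+ 2) + a * b * (2 * v - w) ^+ 2).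
    have -> : (2 * p.+1)%:Z = 2 * a by rewrite /a; clear; lia.
    have -> : (2 * r.+1)%:Z = 2 * b by rewrite /b; clear; lia.
    by rewrite /a /b; ring.
  by rewrite subr_le0 (le_trans h4) // !addr_ge0.
have {}w0 : w = 0 by apply/eqP; rewrite -sqrf_eq0 eq_le w0 sqr_ge0.
rewrite w0 expr2 !mulr0 addr0 pmulr_rge0 // in BA.
rewrite w0 expr2 !mulr0 addr0 pmulr_rge0 // in BB.
have {}q0 : A + B + v ^+ 2 <= 0 by move: q0; rewrite w0 expr2 !mul0r addr0 subr0.
have hv := sqr_ge0 v.
have v0 : v = 0 by apply/eqP; rewrite -sqrf_eq0 eq_le hv andbT; clear -BA BB q0; lia.
split=> // i ir; case: (leqP i p) => ip.
  by apply: EA => //; clear -BB q0 hv; lia.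
have <- : z' (p + r - i)%N = z i by rewrite /z' subKn.
by apply: EB => //; [clear -BA q0 hv; lia | clear -ip ir; lia].
Qed.

Lemma dynkin_form_posdef T x : dynkin_valid T ->
  (forall i, (dynkin_rank T <= i)%N -> x i = 0) ->
  dynkin_form T x <= 0 -> forall i, x i = 0.
Proof.
have branch p r U : ((p%:Z - 1) * (r%:Z - 1) < 4 :> int) ->
    dynkin_rank U = (p + r).+2 ->
    (forall i j, dynkin_link U i j =
       if j == (p + r).+1 then i == p else i.+1 == j) ->
    (forall i, ((p + r).+1 < i)%N -> x i = 0) ->
    dynkin_form U x <= 0 -> forall i, x i = 0.
  move=> pr rU lE xn; pose n := (p + r).+1.
  pose z i : int := if (i < n)%N then x i else 0.
  have zx : {in gtn n, z =1 x} by move=> i; rewrite inE /z => /= ->.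
  have zn : z n = 0 by rewrite /z ltnn.
  rewrite (@dynkin_form_branch _ n p _ z) // ?ltnS ?leq_addr //.
  have <- : z p = x p by rewrite zx // inE ltnS leq_addr.
  move=> q0; have [xn0 z0] := branch_form_posdef pr zn q0.
  move=> i; case: (ltngtP i n) => [ni|/xn //|-> //].
  by rewrite -zx ?inE // z0.
case: T => [n|n|n] /= nv xn.
- rewrite dynkin_form_A ?xn // => A0 i; case: (leqP i n) => [|/ltnW/xn //].
  exact: (arm_eq0 A0 (xn _ (leqnn n))).
- case: n nv xn => [//|[//|[//|[//|n]]]] _ xn.
  apply: (branch n.+1 1%N); rewrite ?subrr ?mulr0 ?addn1 //.
- have {nv} [r rE nE] : exists2 r, (2 <= r <= 4)%N & n = (2 + r).+2.
    by exists (n - 4)%N; lia.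
  rewrite nE in xn *; apply: (branch 2%N r) => //.
  by clear -rE; lia.
Qed.

Section DynkinQuiver.
Variable Q : quiver.
Hypothesis dQ : dynkin Q.

Lemma narrows_le_nedges (i j : vert Q) : (narrows i j <= nedges i j)%N.
Proof. by apply/subset_leq_card/subsetP => a; rewrite !inE => ->. Qed.

Lemma dynkin_loopless : loopless Q.
Proof.
case: dQ => T Tv [f _ nE] i; apply/eqP; rewrite -leqn0.
apply: leq_trans (narrows_le_nedges _ _) _.
by rewrite nE /dynkin_adj dynkin_link_irrefl.
Qed.

Lemma dynkin_simply_laced : simply_laced Q.
Proof.
case: dQ => T _ [f _ nE] i j; apply: leq_trans (narrows_le_nedges _ _) _.
by rewrite nE leq_b1.
Qed.

Lemma euler_double (b : root_lattice Q) : loopless Q ->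
  2 * euler b b = 2 * (\sum_i b i ^+ 2) - \sum_i \sum_j (nedges i j)%:Z * (b i * b j).
Proof.
move=> ll; rewrite /euler.
pose S := \sum_i \sum_j (narrows i j)%:Z * (b i * b j).
have -> : \sum_i b i * (b i - out_sum i b) = \sum_i b i ^+ 2 - S.
  rewrite /S -sumrB; apply: eq_bigr => i _; rewrite mulrBr mulr_sumr; congr (_ - _).
  by apply: eq_bigr => j _; ring.
have -> : \sum_i \sum_j (nedges i j)%:Z * (b i * b j) = S + S.
  have SC : S = \sum_i \sum_j (narrows j i)%:Z * (b j * b i) by exact: exchange_big.
  rewrite {2}SC -big_split; apply: eq_bigr => i _.
  rewrite -big_split; apply: eq_bigr => j _ /=.
  case: (eqVneq i j) => [<-|ij]; last by rewrite nedgesE // PoszD; ring.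
  have -> : nedges i i = narrows i i by apply: eq_card => a; rewrite !inE orbb.
  by rewrite ll !mul0r.
by ring.
Qed.

Lemma dynkin_tits_posdef : tits_posdef Q.
Proof.
have ll := dynkin_loopless; have [T Tv [f fB nE]] := dQ.
move=> b; apply: contraNT; rewrite -leNgt => b0.
have [g fK gK] := fB.
pose x m : int := if insub m is Some o then b (g o) else 0.
have xE i : x (f i) = b i by rewrite /x valK fK.
have xg (o : 'I_(dynkin_rank T)) : x o = b (g o) by rewrite /x valK.
have formE : euler b b = dynkin_form T x.
  suff : 2 * euler b b = 2 * dynkin_form T x by lia.
  rewrite euler_double //.
  pose S := \sum_(i < dynkin_rank T) \sum_(j < dynkin_rank T)
               (dynkin_link T i j)%:Z * (x i * x j).
  have -> : \sum_i \sum_j (nedges i j)%:Z * (b i * b j) = S + S.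
    have SC : S = \sum_(i < dynkin_rank T) \sum_(j < dynkin_rank T)
        (dynkin_link T j i)%:Z * (x j * x i) by exact: exchange_big.
    rewrite {2}SC -big_split [RHS](reindex f) /=; last exact/onW_bij.
    apply: eq_bigr => i _; rewrite -big_split [RHS](reindex f) /=; last exact/onW_bij.
    apply: eq_bigr => j _; rewrite !xE nE /dynkin_adj.
    have := @dynkin_link_antisym T (f i) (f j) Tv (ltn_ord _) (ltn_ord _).
    case: dynkin_link; first by move=> /= ->; rewrite /= mul0r addr0 mul1r.
    by case: dynkin_link => _ /=; rewrite ?mul0r ?add0r ?mul1r // mulrC.
  rewrite /dynkin_form -/S.
  have -> : \sum_i b i ^+ 2 = \sum_(i < dynkin_rank T) x i ^+ 2.
    rewrite [RHS](reindex f) /=; last exact/onW_bij.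
    by apply: eq_bigr => i _; rewrite xE.
  by ring.
rewrite formE in b0.
apply/eqP/ffunP => i; rewrite -xE ffunE; apply: (dynkin_form_posdef Tv _ b0).
by move=> m mT; rewrite /x insubF // ltnNge mT.
Qed.

End DynkinQuiver.

(** * Topological sorting *)

Lemma narrows_neq0 (Q : quiver) (i j : vert Q) :
  narrows i j != 0%N -> exists2 a : arrow Q, tl a = i & hd a = j.
Proof.
rewrite /narrows -lt0n => /card_gt0P[a]; rewrite inE => /andP[/eqP ti /eqP hj].
by exists a.
Qed.

Lemma narrows_arrow (Q : quiver) (a : arrow Q) : narrows (tl a) (hd a) != 0%N.
Proof. by rewrite /narrows -lt0n; apply/card_gt0P; exists a; rewrite inE !eqxx. Qed.

(** Sorting the vertices by the number of vertices that can be reached from them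
    works, because this number decreases strictly along every arrow. *)
Lemma acyclic_vertex_order (Q : quiver) :
  acyclic Q -> exists s : seq (vert Q), vertex_order s.
Proof.
move=> Qac; pose e (i j : vert Q) := narrows i j != 0%N.
have lift p x : path e x p -> exists w : seq (arrow Q), forall a, hd a = x ->
    path (fun a b => hd a == tl b) a w /\ hd (last a w) = last x p.
  elim: p x => [|z p IHp] x /=; first by exists [::].
  case/andP=> /narrows_neq0[a ta ha] /IHp[w wP].
  exists (a :: w) => a' ha' /=.
  by have [-> ->] := wP a ha; rewrite ha' ta eqxx.
(* A path back from [j] to [i] would close up to an oriented cycle. *)
have noback i j : e i j -> ~~ connect e j i.
  move=> /narrows_neq0[a ta ha]; apply/negP => /connectP[p jp ip].
  have [w /(_ a ha)[aw lw]] := lift p j jp.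
  have := Qac (a :: w); rewrite /= rcons_path aw /= lw -ip ta eqxx.
  by move/(_ isT).
pose rk i := #|[set j | connect e i j]|.
have rkP i j : e i j -> (rk j < rk i)%N.
  move=> ij; apply/proper_card/properP; split.
    apply/subsetP => l; rewrite !inE; exact: connect_trans (connect1 ij).
  by exists i; rewrite inE ?connect0 // noback.
pose le i j := (rk i <= rk j)%N.
pose s := sort le (enum (vert Q)); exists s; split.
- by rewrite sort_uniq enum_uniq.
- by move=> i; rewrite mem_sort mem_enum.
have le_tr : transitive le by move=> ? ? ?; apply: leq_trans.
have : pairwise le s.
  rewrite -sorted_pairwise //; apply: sort_sorted => ? ?; exact: leq_total.
apply: sub_pairwise => i j ij; apply: contraT => /rkP.
by rewrite ltnNge [(_ <= _)%N]ij.
Qed.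

Lemma labeling_vertex_order (Q : quiver) (s : seq (vert Q)) :
  labeling s -> vertex_order s.
Proof.
case=> us sT sP; split=> //; case: s us sT sP => // x0 s us sT sP.
apply/(pairwiseP x0) => i j si sj ij; apply: contraT.
move=> /narrows_neq0[a ta ha]; have := sP a.
by rewrite ta ha !index_uniq // ltnNge ltnW.
Qed.

(** * Extension by zero from a full subquiver *)

Section Extension.
Variables (Q : quiver) (S : subquiver Q).
Hypothesis full : forall a : arrow Q,
  tl a \in sub_vert S -> hd a \in sub_vert S -> a \in sub_arrow S.
Local Notation R := (quiver_of_sub S).
Local Notation extend_dimvec := (@extend_dimvec Q S).
Implicit Types (d e : dimvec R) (b : dimvec Q).

Definition supported_on : pred (dimvec Q) :=
  fun b => [forall i, (b i != 0%N) ==> (i \in sub_vert S)].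

Definition restrict_dimvec b : dimvec R := [ffun u => b (val u)].

Lemma extend_dimvec_val d u : extend_dimvec d (val u) = d u.
Proof. by rewrite ffunE valK. Qed.

Lemma extend_dimvec_out d i : i \notin sub_vert S -> extend_dimvec d i = 0%N.
Proof. by move=> iS; rewrite ffunE insubN. Qed.

Lemma supported_on_out b i : supported_on b -> i \notin sub_vert S -> b i = 0%N.
Proof. by move=> /forallP/(_ i) bS iS; apply/eqP; apply: contraR iS; apply/implyP. Qed.

Lemma supported_on_extend d : supported_on (extend_dimvec d).
Proof.
apply/forallP => i; apply/implyP; apply: contraR => iS.
by rewrite extend_dimvec_out.
Qed.

Lemma extend_dimvecK d : restrict_dimvec (extend_dimvec d) = d.
Proof. by apply/ffunP => u; rewrite ffunE extend_dimvec_val. Qed.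

Lemma restrict_dimvecK b : supported_on b ->
  extend_dimvec (restrict_dimvec b) = b.
Proof.
move=> bS; apply/ffunP => i; case: (boolP (i \in sub_vert S)) => iS.
  by rewrite -[i]/(val (Sub i iS : vert R)) extend_dimvec_val ffunE.
by rewrite extend_dimvec_out // supported_on_out.
Qed.

Lemma extend_dimvecD d e :
  extend_dimvec (d + e) = extend_dimvec d + extend_dimvec e.
Proof.
apply/ffunP => i; rewrite dimvec_addE; case: (boolP (i \in sub_vert S)) => iS.
  by rewrite -[i]/(val (Sub i iS : vert R)) !extend_dimvec_val dimvec_addE.
by rewrite !extend_dimvec_out.
Qed.

Lemma extend_dimvec_basis u :
  extend_dimvec (basis_dimvec u) = basis_dimvec (val u).
Proof.
apply/ffunP => i; rewrite [RHS]ffunE; case: (boolP (i \in sub_vert S)) => iS.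
  by rewrite -[i]/(val (Sub i iS : vert R)) extend_dimvec_val ffunE val_eqE.
rewrite extend_dimvec_out //; case: eqP => // ui.
by move: iS; rewrite -ui (valP u).
Qed.

Lemma narrows_sub (u v : vert R) : narrows (val u) (val v) = narrows u v.
Proof.
rewrite /narrows -(card_imset _ val_inj); apply: eq_card => a; rewrite inE.
apply/andP/imsetP => [[/eqP ta /eqP ha]|[a' + ->]].
  have aS : a \in sub_arrow S by apply: full; rewrite (ta, ha) (valP u, valP v).
  exists (Sub a aS) => //; rewrite inE -!val_eqE /= ta ha !eqxx //.
by rewrite inE -!val_eqE /= => /andP.
Qed.

Lemma sum_extend (F : vert Q -> int) : (forall i, i \notin sub_vert S -> F i = 0) ->
  \sum_i F i = \sum_(u : vert R) F (val u).
Proof.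
move=> F0; rewrite -(big_sub (sub_vert S)) [LHS](bigID [in sub_vert S]) /=.
by rewrite [X in _ + X]big1 ?addr0 // => i /F0.
Qed.

Lemma lambda_extend d e : lambda (extend_dimvec d) (extend_dimvec e) = lambda d e.
Proof.
rewrite /lambda sum_extend => [|i iS]; last first.
  rewrite big1 // => j _; rewrite extend_dimvec_out //.
  by rewrite !mul0r.
apply: eq_bigr => u _; rewrite sum_extend => [|i iS]; last first.
  by rewrite (extend_dimvec_out _ iS) mulr0 mul0r.
by apply: eq_bigr => v _; rewrite !extend_dimvec_val !narrows_sub.
Qed.

Lemma extend_bij :
  exponent_bij predT supported_on extend_dimvec restrict_dimvec.
Proof.
split=> //.
- by move=> d e _ _; apply: extend_dimvecD.
- by move=> d _; apply: supported_on_extend.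
- by move=> d _; apply: extend_dimvecK.
- exact: restrict_dimvecK.
- by move=> d e _ _; apply: lambda_extend.
Qed.

Lemma extend_dimvec_eq0 d : (extend_dimvec d == 0) = (d == 0).
Proof.
apply/eqP/eqP => [d0|->]; last exact: (bij0 extend_bij).
by rewrite -[d]extend_dimvecK d0; apply/ffunP => u; rewrite !ffunE.
Qed.

(** The factorization in the subquiver is transported along the extension by zero,
    which preserves [lambda] because the subquiver is full. *)
Lemma subquiver_factorization (s : seq (vert Q)) (phi : seq (dimvec Q)) :
  loopless R -> simply_laced R -> tits_posdef R ->
  vertex_order s -> uniq phi -> pairwise (@lambda_nneg Q) phi ->
  (forall b, b \in phi <->
     exists2 d : dimvec R, positive_root d & b = extend_dimvec d) ->
  \prod_(i <- [seq i <- s | i \in sub_vert S]) qdilog (y (basis_dimvec i)) =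
  \prod_(b <- phi) qdilog (y b).
Proof.
move=> ll sl pd [us sT sA] up pL phiP.
pose t : seq (vert R) := pmap insub s.
have tE : [seq val u | u <- t] = [seq i <- s | i \in sub_vert S].
  rewrite (pmap_filter (@insubK _ _ (vert R))); apply: eq_filter => i /=.
  by rewrite isSome_insub.
have phiS b : b \in phi -> supported_on b.
  by move=> /phiP[d _ ->]; apply: supported_on_extend.
pose psi := [seq restrict_dimvec b | b <- phi].
have tO : vertex_order t.
  split.
  - by rewrite -(map_inj_uniq val_inj) tE filter_uniq.
  - by move=> u; rewrite -(mem_map val_inj) tE mem_filter (valP u) sT.
  have : arrows_backward [seq val u | u <- t].
    by rewrite tE; apply: pairwise_filter.
  rewrite /arrows_backward pairwise_map; apply: sub_pairwise => u v /=.
  by rewrite narrows_sub.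
have psiO : root_order psi.
  split.
  - rewrite map_inj_in_uniq // => b b' /phiS bS /phiS bS' bb.
    by rewrite -(restrict_dimvecK bS) bb restrict_dimvecK.
  - move=> d; split=> [/mapP[b /phiP[e eR ->] ->]|dR]; first by rewrite extend_dimvecK.
    apply/mapP; exists (extend_dimvec d); last by rewrite extend_dimvecK.
    by apply/phiP; exists d.
  rewrite pairwise_map.
  apply: (sub_in_pairwise (P := mem phi)) pL; last exact/allP.
  move=> b b' /phiS bS /phiS bS'.
  by rewrite /= /lambda_nneg -lambda_extend !restrict_dimvecK.
have := congr1 (push supported_on restrict_dimvec)
  (root_factorization ll sl pd tO psiO).
rewrite !(push_qdilog_prod extend_bij); last first.
- by move=> u _; rewrite basis_dimvec_neq0.
- move=> d dp; split=> //; case: psiO => _ psiP _; apply: positive_root_neq0 => //.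
  exact/psiP.
rewrite -tE !big_map => H; transitivity
  (\prod_(u <- t) qdilog (y (extend_dimvec (basis_dimvec u)))).
  by apply: eq_bigr => u _; rewrite extend_dimvec_basis.
rewrite H; apply: eq_big_seq => b /phiS bS; by rewrite restrict_dimvecK.
Qed.

End Extension.

(** * Grouping a sequence by classes *)

Lemma perm_flatten_filter (T J : eqType) (p : J -> pred T) (s : seq T) (js : seq J) :
  uniq js ->
  {in s, forall x, exists2 j, j \in js & {in js, forall k, p k x = (k == j)}} ->
  perm_eq s (flatten [seq filter (p j) s | j <- js]).
Proof.
move=> ujs sp; apply/permP => a; rewrite count_flatten -map_comp sumnE big_map.
transitivity (\sum_(j <- js) \sum_(x <- s) (a x && p j x : nat))%N; last first.
  by apply: eq_bigr => j _; rewrite /= count_filter -sumn_count sumnE big_map.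
rewrite exchange_big /= -sumn_count sumnE big_map; apply: eq_big_seq => x xs.
have [j jjs pj] := sp x xs.
rewrite (bigD1_seq j) //= pj // eqxx andbT big_seq_cond big1 ?addn0 // => k.
by case/andP => kjs kj; rewrite pj // (negPf kj) andbF.
Qed.

Lemma pairwise_flatten_map (T J : eqType) (r : rel T) (f : J -> seq T) (js : seq J) :
  {in js, forall j, pairwise r (f j)} ->
  pairwise (fun j k => allrel r (f j) (f k)) js ->
  pairwise r (flatten (map f js)).
Proof.
elim: js => //= j js IHjs fr /andP[jr pr]; rewrite pairwise_cat.
apply/and3P; split; first 1 last.
- by apply: fr; rewrite mem_head.
- by apply: IHjs => // k kjs; apply: fr; rewrite inE kjs orbT.
apply/allrelP => x z xj /flattenP[_ /mapP[k kjs ->] zk].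
by apply: (allrelP (allP jr _ kjs)).
Qed.

(** * Dynkin subquiver partitions *)

Section Partition.
Variables (Q : quiver) (P : dynkin_partition Q).
Hypothesis adm : admissible P.
Implicit Types (i l : vert Q) (j k : 'I_(nparts P)) (d e : dimvec Q).

Lemma mem_part_of i : i \in sub_vert (part P (part_of P i)).
Proof. exact: xchooseP (part_cover P i). Qed.

Lemma mem_part i j : (i \in sub_vert (part P j)) = (part_of P i == j).
Proof.
apply/idP/eqP => [ij|<-]; last exact: mem_part_of.
apply/eqP; apply: contraT => /(part_disjoint (d := P)) /disjointFr.
by move/(_ _ (mem_part_of i)); rewrite ij.
Qed.

Lemma part_of_arrow j a : a \in sub_arrow (part P j) ->
  part_of P (tl a) = j /\ part_of P (hd a) = j.
Proof.
by move=> aj; split; apply/eqP; rewrite -mem_part; [apply: sub_tl | apply: sub_hd].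
Qed.

(** An arrow with both ends in one part belongs to it, since it would be a loop of
    the contracted quiver otherwise. *)
Lemma part_full j a : tl a \in sub_vert (part P j) -> hd a \in sub_vert (part P j) ->
  a \in sub_arrow (part P j).
Proof.
rewrite !mem_part => /eqP ta /eqP ha; apply: contraT => aj.
have aN : a \notin \bigcup_k sub_arrow (part P k).
  apply/negP => /bigcupP[k _ ak]; have [tk _] := part_of_arrow ak.
  by move: aj; rewrite -ta tk ak.
have := adm (s := [:: Sub a aN : arrow (contraction P)]).
by rewrite /= ta ha eqxx; move/(_ isT).
Qed.

Lemma narrows_contraction i l : part_of P i != part_of P l -> narrows i l != 0%N ->
  @narrows (contraction P) (part_of P i) (part_of P l) != 0%N.
Proof.
move=> il /narrows_neq0[a ta ha].
have aN : a \notin \bigcup_k sub_arrow (part P k).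
  apply/negP => /bigcupP[k _ /part_of_arrow[tk hk]].
  by case/eqP: il; rewrite -ta -ha tk hk.
rewrite -ta -ha; exact: (@narrows_arrow (contraction P) (Sub a aN)).
Qed.

Lemma part_root_supported j d : part_root j d ->
  supported_on (part P j) d /\ d != 0.
Proof.
case=> b bR ->; split; first exact: supported_on_extend.
have ll := dynkin_loopless (@part_dynkin Q P j).
by rewrite extend_dimvec_eq0 ?(positive_root_neq0 ll) //; apply: part_full.
Qed.

Lemma supported_on_uniq j k d : d != 0 ->
  supported_on (part P j) d -> supported_on (part P k) d -> j = k.
Proof.
move=> d0 dj dk; have [i di] : exists i, d i != 0%N.
  apply: contrapT => nd; case/eqP: d0; apply/ffunP => i; rewrite ffunE.
  by apply/eqP; apply: contrapT => /negP di; apply: nd; exists i.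
have := forallP dj i; have := forallP dk i.
by rewrite di !mem_part => /eqP <- /eqP.
Qed.

Definition same_part d e :=
  [exists j, supported_on (part P j) d && supported_on (part P j) e].

Definition partition_rel : rel (dimvec Q) := fun d e =>
  if same_part d e then 0 <= lambda d e else lambda d e <= 0.

Lemma partition_rel_comm d e : d != 0 -> e != 0 ->
  partition_rel d e -> partition_rel e d ->
  qdilog (y d) * qdilog (y e) = qdilog (y e) * qdilog (y d).
Proof.
move=> d0 e0 de ed; apply: qdilog_comm => //; move: de ed.
have -> : partition_rel e d =
    if same_part d e then lambda d e <= 0 else 0 <= lambda d e.
  rewrite /partition_rel (lambdaC d e) oppr_ge0 oppr_le0; congr (if _ then _ else _).
  by apply: eq_existsb => j; rewrite andbC.
rewrite /partition_rel; case: ifP => _ h1 h2; apply/eqP; rewrite eq_le.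
  by rewrite h1 h2.
by rewrite h1 h2.
Qed.

(** All arrows between the two parts point from [k] to [j]. *)
Lemma lambda_parts_le0 j k d e : j != k ->
  @narrows (contraction P) j k = 0%N ->
  supported_on (part P j) d -> supported_on (part P k) e -> lambda d e <= 0.
Proof.
move=> jk njk dj ek; rewrite /lambda sumr_le0 // => i _; apply: sumr_le0 => l _.
case: (boolP (i \in sub_vert (part P j))) => ij; last first.
  by rewrite (supported_on_out dj ij) !mul0r.
case: (boolP (l \in sub_vert (part P k))) => lk; last first.
  by rewrite (supported_on_out ek lk) mulr0 mul0r.
rewrite !mem_part in ij lk; move/eqP: ij => ij; move/eqP: lk => lk.
have -> : narrows i l = 0%N.
  apply/eqP; apply: contraT => nil; have := narrows_contraction _ nil.
  by rewrite ij lk njk => /(_ jk).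
by rewrite sub0r mulrN oppr_le0 mulr_ge0.
Qed.

Section PartitionFactorization.
Variables (s : seq (vert Q)) (phi : seq (dimvec Q)).
Hypotheses (sO : vertex_order s) (up : uniq phi).
Hypothesis phiP : forall d, d \in phi <-> partition_root P d.
Hypothesis phi_rel : pairwise partition_rel phi.

Local Notation s_ j := [seq i <- s | i \in sub_vert (part P j)].
Local Notation phi_ j := [seq d <- phi | supported_on (part P j) d].

Lemma mem_phi_part j d : d \in phi_ j <-> part_root j d.
Proof.
rewrite mem_filter; split=> [/andP[dj /phiP[k dk]]|dj].
  have [dk' d0] := part_root_supported dk.
  by rewrite (supported_on_uniq d0 dj dk').
have [-> _] := part_root_supported dj.
by apply/phiP; exists j.
Qed.

Lemma phi_neq0 d : d \in phi -> d != 0.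
Proof. by move=> /phiP[j /part_root_supported[]]. Qed.

Lemma part_factorization j :
  \prod_(i <- s_ j) qdilog (y (basis_dimvec i)) = \prod_(d <- phi_ j) qdilog (y d).
Proof.
have dj := @part_dynkin Q P j.
apply: subquiver_factorization => //.
- by move=> a; apply: part_full.
- exact: dynkin_loopless.
- exact: dynkin_simply_laced.
- exact: dynkin_tits_posdef.
- exact: filter_uniq.
- apply: (sub_in_pairwise (P := mem (phi_ j))) (pairwise_filter _ phi_rel);
    last exact/allP.
  move=> d e; rewrite !mem_filter => /andP[dS _] /andP[eS _].
  rewrite /partition_rel /lambda_nneg; case: ifP => // /existsP[].
  by exists j; rewrite dS eS.
exact: mem_phi_part.
Qed.

(** Both products are reordered part by part, in a topological order of the
    contracted quiver. *)
Lemma partition_factorization :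
  \prod_(i <- s) qdilog (y (basis_dimvec i)) = \prod_(d <- phi) qdilog (y d).
Proof.
have [js [ujs jsT jsA]] := acyclic_vertex_order adm.
have {jsA} jsA : pairwise (fun j k => (j != k) &&
    (@narrows (contraction P) j k == 0%N)) js.
  by rewrite pairwise_relI -uniq_pairwise ujs.
have [us sT sA] := sO.
have sP : perm_eq s (flatten [seq s_ j | j <- js]).
  apply: perm_flatten_filter => // i _; exists (part_of P i); first by rewrite jsT.
  by move=> k _ /=; rewrite mem_part eq_sym.
have phiE : perm_eq phi (flatten [seq phi_ j | j <- js]).
  apply: perm_flatten_filter => // d dp; have [j dj] := (phiP d).1 dp.
  have [dS d0] := part_root_supported dj.
  exists j; first by rewrite jsT.
  move=> k _ /=; apply/idP/eqP => [dk|->//]; exact: (supported_on_uniq d0 dk dS).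
rewrite (prod_arrows_backward sP sA); last first.
  apply: pairwise_flatten_map => [j _|]; first exact: pairwise_filter.
  apply: sub_pairwise jsA => j k /andP[jk njk]; apply/allrelP => i l.
  rewrite !mem_filter !mem_part => /andP[/eqP ij _] /andP[/eqP lk _].
  apply: contraT => nil; have := narrows_contraction _ nil.
  by rewrite ij lk njk => /(_ jk).
rewrite (prod_perm_pairwise phiE phi_rel); first last.
- by move=> d e dp ep; apply: partition_rel_comm; apply: phi_neq0.
- apply: pairwise_flatten_map => [j _|]; first exact: pairwise_filter.
  apply: sub_pairwise jsA => j k /andP[jk /eqP njk]; apply/allrelP => d e.
  rewrite !mem_filter => /andP[dj dp] /andP[ek ep].
  rewrite /partition_rel; case: ifP => [/existsP[m /andP[dm em]]|_].
    case/eqP: jk; rewrite (supported_on_uniq (phi_neq0 dp) dj dm).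
    exact: (supported_on_uniq (phi_neq0 ep) em ek).
  exact: lambda_parts_le0 dj ek.
rewrite !big_flatten !big_map; apply: eq_bigr => j _; exact: part_factorization.
Qed.

End PartitionFactorization.
End Partition.

Theorem theorem4p2 (Q : quiver) (s : seq (vert Q)) (P : dynkin_partition Q)
    (phi : seq (dimvec Q)) :
  acyclic Q -> labeling s -> admissible P ->
  uniq phi ->
  (forall d : dimvec Q, d \in phi <-> partition_root P d) ->
  (forall u v : nat, (u < v < size phi)%N ->
    (forall j : 'I_(nparts P),
       part_root j (nth 0 phi u) -> part_root j (nth 0 phi v) ->
       0 <= lambda (nth 0 phi u) (nth 0 phi v)) /\
    (forall j k : 'I_(nparts P), j != k ->
       part_root j (nth 0 phi u) -> part_root k (nth 0 phi v) ->
       lambda (nth 0 phi u) (nth 0 phi v) <= 0)) ->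
  DT_invariant s = \prod_(d <- phi) qdilog (y d).
Proof.
move=> _ sL adm up phiP phiL.
apply: (partition_factorization adm (labeling_vertex_order sL) up phiP).
apply/(pairwiseP 0) => u v; rewrite !inE => su sv uv.
have uvs : (u < v < size phi)%N by rewrite uv.
have [same diff] := phiL u v uvs.
have [j uj] := (phiP _).1 (mem_nth 0 su).
have [k vk] := (phiP _).1 (mem_nth 0 sv).
have [uS u0] := part_root_supported adm uj.
have [vS v0] := part_root_supported adm vk.
rewrite /partition_rel; case: ifP => [/existsP[m /andP[um vm]]|nS].
  apply: (same j) => //; have -> // : j = k.
  by rewrite (supported_on_uniq u0 uS um) (supported_on_uniq v0 vm vS).
apply: (diff j k) => //; apply: contraFneq nS => jk.
by apply/existsP; exists k; rewrite vS andbT -jk.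
Qed.
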